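(* Let $n \geq 7$ be an integer with $n \equiv 1$ or $5 \pmod 6$. Then $$D(4n) \;\geq\; 2n + \min\{ D(2n),\, 2n-7 \}.$$
   Context: A Steiner quadruple system of order $m$, SQS$(m)$, is a pair $(Q,B)$ where $Q$ is a set of $m$ points and $B$ is a collection of $4$-subsets (blocks) of $Q$ such that every $3$-subset of $Q$ is contained in exactly one block of $B$; such systems exist iff $m \equiv 2$ or $4 \pmod 6$. Several SQS$(m)$ on the same point set $Q$ are pairwise disjoint if no $4$-subset of $Q$ is a block of two of them. $D(m)$ denotes the largest number of pairwise disjoint SQS$(m)$ on a common $m$-point set. *)

(* Defs.v *)
From mathcomp Require Import all_boot.
Set Implicit Arguments. Unset Strict Implicit. Unset Printing Implicit Defensive.

Definition is_sqs (m : nat) (B : {set {set 'I_m}}) : bool :=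
  [forall b in B, #|b| == 4] &&
  [forall T : {set 'I_m}, (#|T| == 3) ==> (#|[set b in B | T \subset b]| == 1)].

Definition has_disjoint_sqs (m k : nat) : bool :=
  [exists F : {ffun 'I_k -> {set {set 'I_m}}},
     [forall i, is_sqs (F i)] &&
     [forall i, forall j, (i != j) ==> [disjoint F i & F j]]].

(* D(m): the largest k such that there are k pairwise disjoint SQS(m).
   The search range 0..2^m suffices for m >= 3: every SQS(m) is then nonempty,
   and pairwise disjoint nonempty subsets of the 2^m-element type {set 'I_m}
   number at most 2^m. *)
Definition D (m : nat) : nat :=
  \max_(k < (2 ^ m).+1 | has_disjoint_sqs m k) k.

(* Main.v *)
(** Steiner quadruple systems of order 4n are built on two copies of a point set X of size 2n.
    - 2n of them come from one SQS B on X and the rows a of a Latin square on X without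
      2 x 2 subsquares (Lindner): {x, y, z | a w} and {a^-1 w | x, y, z} for the blocks
      {x, y, z, w} of B, together with {x, y | a x, a y} for all pairs.
    - the others come from the doubling construction: blocks of one of the D(2n) disjoint
      systems in each half, together with the {x, y | z, t} such that the colours of xy and
      zt in a one-factorization of K_2n, coloured by Z_(2n-1), differ by a given k.
    The Latin square and the one-factorization are chosen such that the rows of the Latin
    square change colours by -2, -1, 0, 1, 2 or 3 only; the 2n-7 other values of k are free.

    The existence of B is Hanani's theorem, proved by strong induction on the order from
    doubling, tripling, quadrupling and 12-fold constructions. In every construction it is
    enough to cover each triple and to count blocks: if blocks of size at most 4 cover all
    triples and are not more than 'C(v, 3) / 4, then they cover each triple exactly once. *)
Require Import Defs.
From mathcomp Require Import all_boot.
From mathcomp Require Import all_algebra.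
From mathcomp Require Import zify ring.
Set Implicit Arguments. Unset Strict Implicit. Unset Printing Implicit Defensive.
Import GRing.Theory.


(** * Coverings by quadruples *)

(** A Lindner block and a doubling block can only coincide when both have two points in each half,
    and then a row takes a pair of colour c to a pair of colour c + k. So everything rests on rows
    that move colours little. The points are taken as Z_n x {0, 1}; the rows are n translations and
    n reflections exchanging the fibres, and both keep differences inside a fibre up to sign. In the
    plain dihedral table a translation and a reflection share 2 x 2 subsquares; a twist by 1 on one
    fibre removes them, at the price of raising differences across the fibres by 1. Two rows of the
    same kind share no subsquare because n is odd. The colours follow the differences: four
    consecutive ones take the inner difference D and the cross differences 2D - 2 and 2D - 1. A step
    of 1 in a cross difference then costs at most 3 colours, and an unchanged difference at most 2
    either way. These are the six values, and 2n - 7 = (2n - 1) - 6.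

    Hanani's theorem enters because the 2n Lindner systems are claimed outright: B must exist even
    where D(2n) is not known to be positive. *)

Lemma sorted3 (T : Type) (key : T -> nat) (R : T -> T -> T -> Prop) :
  (forall a b c, R a b c -> R b a c) -> (forall a b c, R a b c -> R a c b) ->
  (forall a b c, key a <= key b <= key c -> R a b c) -> forall a b c, R a b c.
Proof.
move=> R12 R23 H a b c.
case: (leqP (key a) (key b)) => ab; case: (leqP (key b) (key c)) => bc;
  case: (leqP (key a) (key c)) => ac; try lia.
- by apply: H; lia.
- by apply/R23/H; lia.
- by apply/R23/R12/H; lia.
- by apply/R12/H; lia.
- by apply/R12/R23/H; lia.
- by apply/R12/R23/R12/H; lia.
Qed.

Lemma uniq3 (T : eqType) (a b c : T) : uniq [:: a; b; c] = [&& a != b, a != c & b != c].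
Proof. by rewrite /= !inE negb_or andbT andbA. Qed.

Section Covering.
Variable P : finType.
Implicit Types (a b c : P) (q : seq P) (L : seq (seq P)).

Definition covered L a b c := has (fun q => [&& a \in q, b \in q & c \in q]) L.

Lemma coveredP L a b c :
  reflect (exists2 q, q \in L & [/\ a \in q, b \in q & c \in q]) (covered L a b c).
Proof.
by apply: (iffP hasP) => -[q qL]; [case/and3P=> *; exists q | case=> *; exists q => //; apply/and3P].
Qed.

Lemma covered_swap12 L a b c : covered L a b c = covered L b a c.
Proof. by apply: eq_has => q; rewrite andbCA. Qed.

Lemma covered_swap23 L a b c : covered L a b c = covered L a c b.
Proof. by apply: eq_has => q; rewrite [(b \in q) && _]andbC. Qed.

Lemma covered_cat L1 L2 a b c :
  covered (L1 ++ L2) a b c = covered L1 a b c || covered L2 a b c.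
Proof. exact: has_cat. Qed.

(** [C] stands for a side condition such as not lying in one group. As it is symmetric, checks by
    computation need only visit increasing triples. *)
Lemma covered_sorted (key : P -> nat) (C : P -> P -> P -> bool) L :
  (forall a b c, C a b c = C b a c) -> (forall a b c, C a b c = C a c b) ->
  (forall a b c, uniq [:: a; b; c] -> C a b c -> key a <= key b <= key c ->
     covered L a b c) ->
  forall a b c, uniq [:: a; b; c] -> C a b c -> covered L a b c.
Proof.
move=> C12 C23 H; apply: (@sorted3 P key) => a b c.
- rewrite covered_swap12 C12 => K U; apply: K; move: U.
  by rewrite !uniq3 [b == a]eq_sym => /and3P[-> -> ->].
- rewrite covered_swap23 C23 => K U; apply: K; move: U.
  by rewrite !uniq3 [c == b]eq_sym => /and3P[-> -> ->].
- by move=> k U Cabc; apply: H.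
Qed.

(** 24 = 4 * 3! clears the denominators of 'C(v, 3) / 4. Points may repeat within an entry and
    entries may coincide; the count excludes both afterwards. *)
Definition quad_list L :=
  [/\ all (fun q => size q <= 4) L,
      forall a b c, uniq [:: a; b; c] -> covered L a b c
    & 24 * size L <= #|P| ^_ 3].

Lemma card_triples (A : {set P}) :
  #|[set t : {set P} | (t \subset A) && (#|t| == 3)]| = 'C(#|A|, 3).
Proof. by rewrite cards_draws. Qed.

Lemma triple_set (t : {set P}) : #|t| == 3 ->
  exists a b c, uniq [:: a; b; c] /\ t = [set a; b; c].
Proof.
move=> t3; have := enum_uniq (mem t); have := cardE t; rewrite (eqP t3).
case E: (enum t) => [|a [|b [|c []]]] //= _ U; exists a, b, c; split=> //.
by apply/setP=> x; rewrite -mem_enum E !inE orbA.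
Qed.

Definition blocks L : {set {set P}} := [set b in [seq [set x in q] | q <- L]].

(* Each list holds at most 4 of the 'C(v, 3) triples and every triple is held,
   so the bound on [size L] forces equality everywhere. *)
Lemma quad_list_exact L : quad_list L ->
  (forall t : {set P}, #|t| = 3 -> count (fun q => t \subset [set x in q]) L = 1)
  /\ (forall q, q \in L -> #|[set x in q]| = 4).
Proof.
case=> /allP L4 cov sz.
pose T := [set t : {set P} | #|t| == 3].
have cT : #|T| = 'C(#|P|, 3) by rewrite -cardsT -card_triples; apply: eq_card => t; rewrite !inE subsetT.
have cq q : q \in L -> 'C(#|[set x in q]|, 3) <= 4 ?= iff (#|[set x in q]| == 4).
  move=> /L4 q4; have : #|[set x in q]| <= 4.
    by rewrite cardsE; apply: leq_trans (card_size q) q4.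
  by case: #|_| => [|[|[|[|[|]]]]].
have dc : \sum_(t in T) count (fun q => t \subset [set x in q]) L
        = \sum_(q <- L) 'C(#|[set x in q]|, 3).
  under eq_bigr do rewrite -sum1_count.
  rewrite (exchange_big_dep xpredT) //=; apply: eq_big_seq => q _.
  by rewrite -card_triples -sum1_card; apply: eq_bigl => t; rewrite !inE andbC.
have ge1 t : t \in T -> 1 <= count (fun q => t \subset [set x in q]) L.
  rewrite inE => /triple_set[a [b [c [U ->]]]]; rewrite -has_count.
  have /coveredP[q qL [aq bq cq']] := cov a b c U.
  by apply/hasP; exists q => //; rewrite !subUset !sub1set !inE aq bq cq'.
have up : \sum_(q <- L) 'C(#|[set x in q]|, 3) <= 4 * size L.
  rewrite -sum1_size big_distrr /= [leqLHS]big_seq_cond [leqRHS]big_seq_cond muln1.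
  by apply: leq_sum => q /andP[/cq[]].
have lo : #|T| <= \sum_(t in T) count (fun q => t \subset [set x in q]) L.
  by rewrite -sum1_card; apply: leq_sum.
have bin6 : 6 * 'C(#|P|, 3) = #|P| ^_ 3 by rewrite mulnC bin_ffact.
have tot : 4 * size L <= #|T| by rewrite cT; lia.
have eqT : \sum_(t in T) count (fun q => t \subset [set x in q]) L = #|T|.
  by apply/eqP; rewrite eqn_leq lo dc (leq_trans up tot).
split.
  move=> t /eqP t3; have tT : t \in T by rewrite inE.
  apply/eqP; rewrite eqn_leq ge1 // andbT leqNgt; apply/negP=> gt1.
  suff : #|T| < #|T| by rewrite ltnn.
  rewrite -{2}eqT -sum1_card (bigD1 t) //= [ltnRHS](bigD1 t) //=.
  rewrite -addnS addnC addSn -addnS addnC; apply: leq_add => //.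
  by apply: leq_sum => u /andP[/ge1].
move=> q qL; apply/eqP; apply/negPn/negP=> qn.
have : \sum_(q <- L) 'C(#|[set x in q]|, 3) < 4 * size L.
  rewrite (perm_size (perm_to_rem qL)) (perm_big _ (perm_to_rem qL)) big_cons /= mulnS.
  rewrite -addSn; apply: leq_add; first by rewrite (ltn_leqif (cq _ qL)).
  rewrite -sum1_size big_distrr /= [leqLHS]big_seq_cond [leqRHS]big_seq_cond muln1.
  by apply: leq_sum => p /andP[/mem_rem/cq[]].
by rewrite -dc eqT ltnNge tot.
Qed.

End Covering.


(** * Steiner quadruple systems as sets of blocks, and their transport *)

Definition sqs (P : finType) (B : {set {set P}}) :=
  (forall b, b \in B -> #|b| = 4) /\
  (forall t : {set P}, #|t| = 3 -> #|[set b in B | t \subset b]| = 1).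

Lemma is_sqsP m (B : {set {set 'I_m}}) : reflect (sqs B) (is_sqs B).
Proof.
apply: (iffP andP) => [[/forallP H /forallP K] | [H K]]; split.
- by move=> b bB; apply/eqP; have /implyP := H b; apply.
- by move=> t t3; apply/eqP; have /implyP := K t; apply; apply/eqP.
- by apply/forallP => b; apply/implyP => /H ->.
- by apply/forallP => t; apply/implyP => /eqP /K ->.
Qed.

Lemma sqs_blocks (P : finType) (L : seq (seq P)) : quad_list L -> sqs (blocks L).
Proof.
move=> QL; have [cnt c4] := quad_list_exact QL; split=> [b|t t3].
  by rewrite inE => /mapP[q /c4 qL ->].
apply/eqP; rewrite eqn_leq; apply/andP; split.
  rewrite -(cnt t t3) -(count_map (fun q : seq P => [set x in q]) (fun b => t \subset b)).
  rewrite -size_filter; set s := filter _ _; apply: leq_trans (card_size s).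
  by apply/subset_leq_card/subsetP => b; rewrite !inE mem_filter andbC.
have [q qL tq] : exists2 q, q \in L & t \subset [set x in q].
  by apply/hasP; rewrite has_count cnt.
by apply/card_gt0P; exists [set x in q]; rewrite !inE tq map_f.
Qed.

(** Converse of [sqs_blocks], so that a known system can enter the next construction. Counting pairs
    of a triple and a block containing it in two ways makes the bound an equality. *)
Lemma quad_list_enum (P : finType) (B : {set {set P}}) : sqs B ->
  quad_list [seq enum b | b : {set P} <- enum B].
Proof.
case=> B4 Bt; split.
- by apply/allP=> q /mapP[b]; rewrite mem_enum => /B4 b4 ->; rewrite -cardE b4.
- move=> a b c U; have t3 : #|[set a; b; c]| = 3.
    by move: U; rewrite -setUA !cardsU1 /= !inE !negb_or cards1 => /andP[/andP[-> ->] /andP[-> _]].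
  have /card_gt0P[d] : 0 < #|[set d in B | [set a; b; c] \subset d]| by rewrite Bt.
  rewrite inE !subUset !sub1set => /andP[dB /andP[/andP[ad bd] cd]].
  apply/coveredP; exists (enum d); first by apply: map_f; rewrite mem_enum.
  by rewrite !mem_enum.
- rewrite size_map -cardE.
  suff -> : #|P| ^_ 3 = 6 * (4 * #|B|) by rewrite mulnA.
  rewrite -bin_ffact mulnC -cardsT -card_triples; congr muln.
  transitivity (\sum_(t : {set P} | #|t| == 3) #|[set b in B | t \subset b]|).
    by rewrite -sum1_card; apply: eq_big => t; rewrite inE subsetT //= => /eqP/Bt->.
  under eq_bigr do rewrite -sum1_card.
  rewrite (exchange_big_dep (mem B)) /=; last by move=> t b _; rewrite inE => /andP[].
  rewrite mulnC -sum_nat_const; apply: eq_bigr => b bB.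
  have <- : 'C(#|b|, 3) = 4 by rewrite (B4 b bB).
  rewrite -card_triples -sum1_card.
  by apply: eq_bigl => t; rewrite !inE bB andbC.
Qed.

Lemma sqs_imset (P Q : finType) (f : P -> Q) (B : {set {set P}}) :
  bijective f -> sqs B -> sqs [set f @: (b : {set P}) | b in B].
Proof.
move=> fb [B4 Bt]; have fi := bij_inj fb; split.
  by move=> _ /imsetP[b /B4 b4 ->]; rewrite card_imset.
move=> t t3; have ft : f @: (f @^-1: t) = t.
  have [g _ gK] := fb; apply/setP => y; apply/imsetP/idP => [[x + ->] | yt].
    by rewrite inE.
  by exists (g y); rewrite ?inE gK.
rewrite -(Bt (f @^-1: t)); last by rewrite -(card_imset _ fi) ft.
rewrite -(card_imset _ (imset_inj fi)); apply: eq_card => c; rewrite !inE.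
apply/andP/imsetP=> [[/imsetP[b bB ->]] tb | [b]].
  exists b => //; rewrite inE bB; apply/subsetP => x; rewrite inE => /(subsetP tb).
  by rewrite mem_imset.
by rewrite inE => /andP[bB tb] ->; rewrite imset_f // -ft imsetS.
Qed.

Lemma card_bij (P Q : finType) : #|P| = #|Q| -> exists f : P -> Q, bijective f.
Proof.
move=> e; exists (fun x => enum_val (cast_ord e (enum_rank x))).
exists (fun y => enum_val (cast_ord (esym e) (enum_rank y))) => x;
  by rewrite enum_valK ?cast_ordK ?cast_ordKV enum_rankK.
Qed.

Definition sqs_exists v := exists B : {set {set 'I_v}}, sqs B.

Lemma sqs_exists_list (P : finType) (L : seq (seq P)) :
  quad_list L -> sqs_exists #|P|.
Proof.
move=> /sqs_blocks QL; have [|f fb] := @card_bij P 'I_#|P|; first by rewrite card_ord.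
by eexists; apply: sqs_imset fb QL.
Qed.

Lemma sqs_exists_type (P : finType) : sqs_exists #|P| -> exists B : {set {set P}}, sqs B.
Proof.
case=> B QB; have [|f fb] := @card_bij 'I_#|P| P; first by rewrite card_ord.
by eexists; apply: sqs_imset fb QB.
Qed.

Lemma disjoint_imset (P Q : finType) (f : P -> Q) (A B : {set P}) :
  injective f -> [disjoint A & B] -> [disjoint f @: A & f @: B].
Proof. move=> fi; rewrite -!setI_eq0 -imsetI; last exact: in2W fi.
by move=> /eqP->; rewrite imset0. Qed.

Lemma has_disjoint_sqs_type (P I : finType) (F : I -> {set {set P}}) :
  (forall i, sqs (F i)) -> (forall i j, i != j -> [disjoint F i & F j]) ->
  has_disjoint_sqs #|P| #|I|.
Proof.
move=> QF dF; have [|f fb] := @card_bij P 'I_#|P|; first by rewrite card_ord.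
apply/existsP; exists [ffun i => [set f @: (b : {set P}) | b in F (enum_val i)]]; apply/andP; split.
  by apply/forallP=> i; rewrite ffunE; apply/is_sqsP/sqs_imset.
apply/forallP => i; apply/forallP => j; apply/implyP => ij; rewrite !ffunE.
apply: disjoint_imset; first exact: imset_inj (bij_inj fb).
by apply: dF; rewrite (inj_eq enum_val_inj).
Qed.

Lemma disjoint_sqs_of m k (P : finType) : #|P| = m -> has_disjoint_sqs m k ->
  exists F : 'I_k -> {set {set P}},
    (forall i, sqs (F i)) /\ (forall i j, i != j -> [disjoint F i & F j]).
Proof.
move=> Pm /existsP[F /andP[/forallP QF /forallP dF']].
have dF i j : i != j -> [disjoint F i & F j] by have /forallP/(_ j)/implyP := dF' i.
have [|f fb] := @card_bij 'I_m P; first by rewrite card_ord.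
exists (fun i => [set f @: (b : {set 'I_m}) | b in F i]); split=> [i|i j /dF ij].
  by apply: sqs_imset => //; apply/is_sqsP.
by apply: disjoint_imset => //; apply: imset_inj (bij_inj fb).
Qed.

Lemma leq_D m k : k <= 2 ^ m -> has_disjoint_sqs m k -> k <= D m.
Proof.
rewrite -ltnS => km H; rewrite /D.
exact: (@leq_bigmax_cond _ (fun k : 'I__ => has_disjoint_sqs m k) _ (Ordinal km)). Qed.

Lemma has_disjoint_sqs_D m : has_disjoint_sqs m (D m).
Proof.
rewrite /D; apply: (big_ind (has_disjoint_sqs m)) => [|k l Hk Hl|i //].
  apply/existsP; exists [ffun i => set0].
  by apply/andP; split; apply/forallP; case.
by rewrite /maxn; case: ifP.
Qed.


(** * Filling groups *)

Section Map.
Variables (P Q : finType) (f : P -> Q).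

Lemma covered_map (L : seq (seq P)) a b c :
  covered L a b c -> covered [seq map f q | q <- L] (f a) (f b) (f c).
Proof.
by move=> /coveredP[q qL [aq bq cq]]; apply/coveredP; exists (map f q); rewrite ?map_f.
Qed.

End Map.

Lemma all_size_map (T U : Type) (f : T -> U) (L : seq (seq T)) :
  all (fun q => size q <= 4) L -> all (fun q => size q <= 4) [seq map f q | q <- L].
Proof. by rewrite all_map; congr is_true; apply: eq_all => q /=; rewrite size_map. Qed.


Lemma covered_sub (P : finType) (L L' : seq (seq P)) a b c :
  {subset L <= L'} -> covered L a b c -> covered L' a b c.
Proof. by move=> sL /coveredP[q /sL qL H]; apply/coveredP; exists q. Qed.

(** Used to move a block onto the stem and a point onto [None]. Each set is listed before its
    complement, and positions are matched. *)
Lemma set_bij (P : finType) (A B : {set P}) : #|A| = #|B| ->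
  exists2 f : P -> P, bijective f & f @: A = B.
Proof.
move=> eAB; have eC : #|~: A| = #|~: B| by have := cardsC A; have := cardsC B; lia.
pose eA := enum A ++ enum (~: A); pose eB := enum B ++ enum (~: B).
have uAB (C : {set P}) : uniq (enum C ++ enum (~: C)).
  rewrite cat_uniq !enum_uniq /= andbT; apply/hasPn=> x.
  by rewrite !mem_enum inE.
have sAB : size eA = size eB by rewrite !size_cat -!cardE eAB eC.
have inA x : x \in eA by rewrite mem_cat !mem_enum inE orbN.
pose f x := nth x eB (index x eA).
have fi : injective f.
  move=> x y; have := inA x; have := inA y; rewrite -!index_mem => iy ix.
  rewrite /f (set_nth_default y) -?sAB // => /eqP.
  by rewrite nth_uniq -?sAB ?uAB // => /eqP/index_inj; apply.
exists f; first exact: injF_bij.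
apply/eqP; rewrite eqEcard card_imset // eAB leqnn andbT.
apply/subsetP=> _ /imsetP[x xA ->]; rewrite /f.
have ix : index x eA = index x (enum A) by rewrite index_cat mem_enum xA.
have lx : index x (enum A) < size (enum B) by rewrite -cardE -eAB cardE index_mem mem_enum.
by rewrite ix nth_cat lx -mem_enum mem_nth.
Qed.

Lemma size_flatten_leq (T : eqType) (U : Type) (f : T -> seq U) (s : seq T) k :
  (forall x, x \in s -> size (f x) <= k) -> size (flatten [seq f x | x <- s]) <= size s * k.
Proof.
elim: s => //= x s IH H; rewrite size_cat mulSn leq_add ?H ?mem_head //.
by apply: IH => y ys; rewrite H // inE ys orbT.
Qed.

Section Groups.
Variables G W S : finType.

(** Stem points count as members of every group. The relation is therefore not transitive, and
    [one_group] has to test all three pairs. *)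
Definition same_group (a b : G * W + S) :=
  match a, b with inl (x, _), inl (y, _) => x == y | _, _ => true end.

Definition one_group (a b c : G * W + S) := [&& same_group a b, same_group a c & same_group b c].

Definition in_group (x : G) (p : W + S) : G * W + S :=
  match p with inl w => inl (x, w) | inr s => inr s end.

Lemma in_group_inj x : injective (in_group x).
Proof. by move=> [w|s] [w'|s'] //= [->]. Qed.

Definition in_stem (p : W + S) := if p is inr _ then true else false.

(** All groups share the stem, so blocks inside it may be laid only once. At most two stem points
    contain no triple (n = 0); four stem points are made a block by relabelling, and this block is
    dropped from [L] and counted by n = 1. *)
Lemma split_stem : (#|S| <= 2) || (#|S| == 4) -> sqs_exists (#|W| + #|S|) ->
  exists L : seq (seq (W + S)), exists n,
  [/\ all (fun q => size q <= 4) L,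
   forall a b c, uniq [:: a; b; c] -> ~~ [&& in_stem a, in_stem b & in_stem c] ->
     covered L a b c,
   24 * n = #|S| ^_ 3 & 24 * (size L + n) <= (#|W| + #|S|) ^_ 3].
Proof.
have <- : #|{: W + S}| = #|W| + #|S| by rewrite card_sum.
move=> Sle /sqs_exists_type[B sB].
case/orP: Sle => [S2|/eqP S4].
  have [L4 Lc Ln] := quad_list_enum sB.
  exists [seq enum b | b : {set _} <- enum B], 0; split=> //.
  - by move=> a b c U _; exact: Lc.
  - by case: #|S| S2 => [|[|[]]].
  - by rewrite addn0.
pose st : {set W + S} := [set inr s | s in S].
have st4 : #|st| = 4 by rewrite card_imset //; move=> ? ? [].
have [b0 b0B] : exists b, b \in B.
  have [t tst t3] : exists2 t : {set W + S}, t \subset st & #|t| = 3.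
    have : 0 < #|[set t : {set W + S} | t \subset st & #|t| == 3]|.
      by rewrite card_triples st4.
    by case/card_gt0P=> t; rewrite inE => /andP[? /eqP ?]; exists t.
  have /card_gt0P[b] : 0 < #|[set b in B | t \subset b]| by rewrite sB.2.
  by rewrite inE => /andP[bB _]; exists b.
have [f fb fst] : exists2 f : W + S -> W + S, bijective f & f @: b0 = st.
  by apply: set_bij; rewrite st4 sB.1.
have sC := sqs_imset fb sB; set C := [set _ | _ in B] in sC.
have stC : st \in C by apply/imsetP; exists b0.
have [L4 Lc Ln] := quad_list_enum sC.
exists [seq enum b | b : {set _} <- rem st (enum C)], 1; split=> //.
- by apply/allP=> q /mapP[b /mem_rem bC ->]; apply: (allP L4); apply: map_f.
- move=> a b c /Lc /coveredP[_ /mapP[d dC ->] []]; rewrite !mem_enum => ad bd cd.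
  rewrite -/(in_stem _) => nst; apply/coveredP; exists (enum d); last by rewrite !mem_enum.
  apply: map_f; rewrite mem_rem_uniq ?enum_uniq // inE dC andbT.
  apply: contra nst => /eqP ds; rewrite {}ds {dC} in ad bd cd.
  by case/imsetP: ad bd cd => ? _ -> /imsetP[? _ ->] /imsetP[? _ ->].
- by rewrite S4.
- move: Ln; rewrite !size_map size_rem ?mem_enum //.
  by rewrite addn1 prednK // -cardE; apply/card_gt0P; exists st.
Qed.

(** The numerical hypothesis is the count of triples with the subtractions moved across: each group
    accounts for the triples it forms with the stem, but triples inside the stem count once and not
    once per group. *)
Lemma fill_groups (L : seq (seq (G * W + S))) :
  (#|S| <= 2) || (#|S| == 4) -> sqs_exists (#|W| + #|S|) ->
  all (fun q => size q <= 4) L ->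
  (forall a b c, uniq [:: a; b; c] -> ~~ one_group a b c -> covered L a b c) ->
  24 * size L + #|G| * (#|W| + #|S|) ^_ 3 + #|S| ^_ 3
     <= (#|G| * #|W| + #|S|) ^_ 3 + #|G| * #|S| ^_ 3 ->
  0 < #|G| -> sqs_exists (#|G| * #|W| + #|S|).
Proof.
move=> Sle eWS L4 Lc Ln /card_gt0P[x0 _].
have [F [n [F4 Fc nS Fn]]] := split_stem Sle eWS.
pose LG := flatten [seq [seq map (in_group x) q | q <- F] | x <- enum G].
pose LS : seq (seq (G * W + S)) := nseq n [seq inr s | s <- enum S].
have -> : #|G| * #|W| + #|S| = #|{: G * W + S}| by rewrite card_sum card_prod.
apply: (@sqs_exists_list _ (L ++ LG ++ LS)); split.
- rewrite !all_cat L4 /=; apply/andP; split; last first.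
    rewrite all_nseq size_map -cardE; case: n nS {LS Fn} => //= n nS.
    by case/orP: Sle => [|/eqP-> //]; case: #|S| nS => [|[|[]]].
  by apply/allP=> q /flatten_mapP[x _] /(allP (all_size_map _ F4)).
- move=> a b c U; rewrite !covered_cat.
  have [one|/Lc-> //] := boolP (one_group a b c); apply/orP; right.
  have emb x a' b' c' : a = in_group x a' -> b = in_group x b' -> c = in_group x c' ->
      ~~ [&& in_stem a', in_stem b' & in_stem c'] -> covered LG a b c.
    move=> ea eb ec ns; subst a b c; apply: (@covered_sub _ [seq map (in_group x) q | q <- F]).
      by move=> q qF; apply/flatten_mapP; exists x; rewrite ?mem_enum.
    apply: covered_map; apply: Fc => //.
    by rewrite -(map_inj_uniq (@in_group_inj x)).
  case: a b c one U emb => [[x i]|a] [[y j]|b] [[z k]|c]; rewrite /one_group /=.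
  + by case/and3P=> /eqP <- /eqP <- _ _ /(_ x (inl i) (inl j) (inl k)) ->.
  + by case/andP=> /eqP <- _ _ /(_ x (inl i) (inl j) (inr c)) ->.
  + by case/andP=> /eqP <- _ _ /(_ x (inl i) (inr b) (inl k)) ->.
  + by move=> _ _ /(_ x (inl i) (inr b) (inr c)) ->.
  + by move=> /eqP <- _ /(_ y (inr a) (inl j) (inl k)) ->.
  + by move=> _ _ /(_ y (inr a) (inl j) (inr c)) ->.
  + by move=> _ _ /(_ z (inr a) (inr b) (inl k)) ->.
  move=> _ U _; apply/orP; right; rewrite /LS.
  case: n nS {LS Fn} => [|n _]; last first.
    by apply/coveredP; exists [seq inr s | s <- enum S]; rewrite ?mem_head ?map_f ?mem_enum.
  rewrite muln0 => /esym S0; suff: 2 < #|S| by case: #|S| S0 => [|[|[]]].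
  have {}U : uniq [:: a; b; c] by [].
  by have := max_card (mem [:: a; b; c]); rewrite (card_uniqP U).
- have : size LG <= #|G| * size F.
    by rewrite cardE; apply: size_flatten_leq => x _; rewrite size_map.
  have := leq_mul (leqnn #|G|) Fn; move: Ln; rewrite -nS.
  rewrite !size_cat size_nseq card_sum card_prod.
  move: ((#|W| + #|S|) ^_ 3) ((_ + _) ^_ 3) (size LG) (size L) (size F) #|G| => w3 t3 lg l f g; nia.
Qed.
End Groups.


Lemma ffact3E n : n ^_ 3 + 3 * n ^ 2 = n ^ 3 + 2 * n.
Proof.
by case: n => [|[|n]] //; rewrite !ffactSS ffactn1 !expnS expn0; lia.
Qed.

Lemma quad_list_map (P Q : finType) (f : P -> Q) (L : seq (seq P)) :
  bijective f -> quad_list L -> quad_list [seq map f q | q <- L].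
Proof.
move=> fb [L4 Lc Ln]; have [g fK gK] := fb; split; first exact: all_size_map.
  move=> a b c U; rewrite -[a]gK -[b]gK -[c]gK; apply: covered_map; apply: Lc.
  by rewrite -(map_inj_uniq (bij_inj fb)) /= !gK.
by rewrite size_map -(bij_eq_card fb).
Qed.

(** Some point lies on at most the average number x(x - 1)/6 of blocks, where x = #|X|, and is
    renamed [None]. [weighting] replaces the blocks through [None] by the larger ingredient, so they
    must be few. *)
Lemma sparse_point (X : finType) : sqs_exists #|X|.+1 ->
  exists2 L : seq (seq (option X)), quad_list L
    & 6 * count (fun q => None \in q) L + #|X| <= #|X| ^ 2.
Proof.
rewrite -card_option => /sqs_exists_type[B sB].
have [A sA] : exists A : option X, 6 * count (fun q => A \in q) [seq enum b | b : {set _} <- enum B] + #|X| <= #|X| ^ 2.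
  set L := [seq _ | _ <- _]; have [L4 _ Ln] := quad_list_enum sB; rewrite -/L in L4 Ln.
  apply/existsP; apply: contraT => /existsPn H.
  have le4 : \sum_A count (fun q : seq (option X) => A \in q) L <= 4 * size L.
    under eq_bigr do rewrite -sum1_count.
    rewrite (exchange_big_dep xpredT) //= -sum1_size big_distrr /= [leqLHS]big_seq_cond [leqRHS]big_seq_cond.
    apply: leq_sum => q /andP[/(allP L4) q4 _]; rewrite muln1 sum1_card.
    exact: leq_trans (card_size q) q4.
  have ge : #|{: option X}| * (#|X| ^ 2 - #|X|).+1 <= 6 * \sum_A count (fun q : seq (option X) => A \in q) L.
    rewrite big_distrr /= -sum_nat_const; apply: leq_sum => A _.
    have := H A; rewrite -ltnNge; move: (count _ _) #|X| => c x.
    by have : x <= x ^ 2; [case: x => // x; rewrite leq_pmulr | lia].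
  move: Ln ge le4; rewrite card_option; have := ffact3E #|X|.+1.
  move: (bigop _ _ _) (size L) (#|X|.+1 ^_ 3) => c l f.
  move: #|X| => x; rewrite !expnS expn0 !muln1; nia.
have [f fb fA] := @set_bij _ [set A] [set None] (etrans (cards1 _) (esym (cards1 _))).
have {}fA : f A = None by apply/set1P; rewrite -fA imset_f ?set11.
exists [seq map f q | q <- [seq enum b | b : {set _} <- enum B]].
  exact/quad_list_map/quad_list_enum.
rewrite count_map; apply: leq_trans sA; rewrite leq_add2r leq_mul2l /=.
by apply: sub_count => q /=; rewrite -fA mem_map //; exact: bij_inj.
Qed.


(** * Weighting *)

Section Weighting.
Variables (X : finType) (W : finZmodType) (S : finType).
Variable L3 : seq (seq ('I_3 * W + S)).
Hypothesis L3_size : all (fun q => size q <= 4) L3.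
Hypothesis L3_cover : forall a b c,
  uniq [:: a; b; c] -> ~~ one_group a b c -> covered L3 a b c.
Variable x0 : X.

Definition emb3 (r : seq X) (p : 'I_3 * W + S) : X * W + S :=
  match p with inl (i, w) => inl (nth x0 r i, w) | inr s => inr s end.

Definition derived_blocks (r : seq X) := [seq map (emb3 r) t | t <- L3].

Definition zero_sum_block (r : seq X) (t : W * W * W) : seq (X * W + S) :=
  [:: inl (nth x0 r 0, t.1.1); inl (nth x0 r 1, t.1.2); inl (nth x0 r 2, t.2);
      inl (nth x0 r 3, - (t.1.1 + t.1.2 + t.2))%R].

Definition zero_sum_blocks (r : seq X) := [seq zero_sum_block r t | t <- enum {: W * W * W}].

Definition grp (p : X * W + S) : option X := if p is inl (x, _) then Some x else None.

Lemma derived_cover (q : seq (option X)) a b c :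
  size q <= 4 -> None \in q -> grp a \in q -> grp b \in q -> grp c \in q ->
  uniq [:: a; b; c] -> ~~ one_group a b c ->
  covered (derived_blocks (pmap id q)) a b c.
Proof.
move=> q4 Nq aq bq cq U ng; set r := pmap id q.
have r3 : size r <= 3.
  rewrite size_pmap -ltnS; apply: leq_trans q4; rewrite -(count_predC isSome q).
  by rewrite -addn1 leq_add2l -has_count; apply/hasP; exists None.
have rP x : Some x \in q -> index x r < 3.
  by move=> xq; apply: leq_trans r3; rewrite index_mem mem_pmap; apply/mapP; exists (Some x).
pose pre (p : X * W + S) : 'I_3 * W + S :=
  match p with inl (x, w) => inl (inord (index x r), w) | inr s => inr s end.
have preK p : grp p \in q -> emb3 r (pre p) = p.
  case: p => [[x w]|s] //= xq; rewrite inordK ?rP // nth_index //.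
  by rewrite mem_pmap; apply/mapP; exists (Some x).
rewrite -[a]preK // -[b]preK // -[c]preK //; apply: covered_map; apply: L3_cover.
  by apply: (@map_uniq _ _ (emb3 r)); rewrite /= !preK.
apply: contra ng; rewrite -{2}[a]preK // -{2}[b]preK // -{2}[c]preK //.
have sg p p' : same_group p p' -> same_group (emb3 r p) (emb3 r p').
  by case: p p' => [[i w]|s] [[i' w']|s'] //= /eqP->.
by case/and3P=> ? ? ?; apply/and3P; split; apply: sg.
Qed.

(** Three coordinates of a zero-sum quadruple determine the fourth. Once the three groups are sorted
    by index in [r], the index left out gives the four cases. *)
Lemma zero_sum_cover (q : seq (option X)) a b c :
  size q <= 4 -> None \notin q -> grp a \in q -> grp b \in q -> grp c \in q ->
  uniq [:: grp a; grp b; grp c] ->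
  covered (zero_sum_blocks (pmap id q)) a b c.
Proof.
move=> q4 Nq aq bq cq U; set r := pmap id q.
have r4 : size r <= 4 by rewrite size_pmap; apply: leq_trans (count_size _ _) q4.
have inr' p : grp p \in q -> exists x w, p = inl (x, w) /\ x \in r.
  case: p => [[x w]|s] /= pq; last by rewrite pq in Nq.
  by exists x, w; split=> //; rewrite mem_pmap; apply/mapP; exists (Some x).
have [x [i [ea xr]]] := inr' a aq; have [y [j [eb yr]]] := inr' b bq.
have [z [k [ec zr]]] := inr' c cq; subst a b c.
have {}U : uniq [:: x; y; z] by [].
move: xr yr zr U {aq bq cq}.
pose key (p : X * W) := index p.1 r.
pose R p p' p'' := p.1 \in r -> p'.1 \in r -> p''.1 \in r -> uniq [:: p.1; p'.1; p''.1] ->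
   covered (zero_sum_blocks r) (inl p) (inl p') (inl p'').
apply: (@sorted3 _ key R _ _ _ (x, i) (y, j) (z, k)) => {x y z i j k} [a b c|a b c|].

- rewrite /R covered_swap12 => H br ar cr U; apply: H => //; move: U.
  by rewrite !uniq3 [b.1 == a.1]eq_sym => /and3P[-> -> ->].
- rewrite /R covered_swap23 => H ar cr br U; apply: H => //; move: U.
  by rewrite !uniq3 [c.1 == b.1]eq_sym => /and3P[-> -> ->].
move=> [x i] [y j] [z k]; rewrite /key /R => /= xyz xr yr zr U; have {}U : uniq [:: x; y; z] by [].
have lt u v : u \in r -> v \in r -> u != v -> index u r <= index v r -> index u r < index v r.
  by move=> ur vr uv; rewrite leq_eqVlt => /predU1P[/index_inj e|//]; rewrite e ?eqxx in uv.
have [xy yz zr4] : [/\ index x r < index y r, index y r < index z r & index z r < 4].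
  move: U; rewrite uniq3 => /and3P[xy xz yz]; case/andP: xyz => Hxy Hyz.
  by split; [exact: lt | exact: lt | rewrite (leq_trans _ r4) // index_mem].
have nx u : u \in r -> nth x0 r (index u r) = u by exact: nth_index.
have cov t : [&& inl (x, i) \in zero_sum_block r t, inl (y, j) \in zero_sum_block r t
      & inl (z, k) \in zero_sum_block r t] ->
    covered (zero_sum_blocks r) (inl (x, i)) (inl (y, j)) (inl (z, k)).
  move=> H; apply/hasP; exists (zero_sum_block r t) => //.
  by apply: map_f; rewrite mem_enum.
rewrite /zero_sum_block in cov.
have bal (s u : W) : (- (s - (s + u)) = u)%R by rewrite opprD opprK addKr.
move: (nx x xr) (nx y yr) (nx z zr) xy yz zr4 cov.
case: (index x r) => [|[|[|[|]]]]; case: (index y r) => [|[|[|[|]]]] //;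
case: (index z r) => [|[|[|[|]]]] // -> -> -> _ _ _ cov.
- by apply: (cov (i, j, k)); rewrite !inE !eqxx ?orbT.
- apply: (cov (i, j, - (i + j + k))%R).
  by rewrite /= bal !inE !eqxx ?orbT.
- apply: (cov (i, - (i + j + k), j)%R).
  by rewrite /= [(i - _ + j)%R]addrAC bal !inE !eqxx ?orbT.
apply: (cov (- (i + j + k), i, j)%R).
by rewrite /= -[(_ + i + j)%R]addrA [(_ + (i + j))%R]addrC bal !inE !eqxx ?orbT.
Qed.

(** Each point of [X] is inflated to a group and [None] to the stem. A block through [None] becomes
    a copy of [L3] on its three groups, any other block becomes |W|^3 zero-sum quadruples. Since
    [L3] has at least that size, the total grows with the number of blocks through [None], which
    [sparse_point] bounds. *)
Theorem weighting : #|S| <= 2 -> sqs_exists #|X|.+1 -> sqs_exists (#|W| + #|S|) ->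
  #|W| ^ 3 <= size L3 ->
  24 * size L3 + 3 * (#|W| + #|S|) ^_ 3 <= (3 * #|W| + #|S|) ^_ 3 + 2 * #|S| ^_ 3 ->
  sqs_exists (#|X| * #|W| + #|S|).
Proof.
move=> S2 /sparse_point[M [M4 Mc Mn] Mp] eWS cL3 nL3.
pose MN := [seq q <- M | None \in q]; pose MO := [seq q <- M | None \notin q].
pose LD := flatten [seq derived_blocks (pmap id q) | q <- MN].
pose LH := flatten [seq zero_sum_blocks (pmap id q) | q <- MO].
apply: (@fill_groups _ _ _ (LD ++ LH)) => //; last by apply/card_gt0P; exists x0.
- by rewrite S2.
- rewrite all_cat; apply/andP; split; apply/allP => q /flatten_mapP[r _].
    by move=> /(allP (all_size_map _ L3_size)).
  by case/mapP=> t _ ->.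
- move=> a b c U ng; rewrite covered_cat.
  have derived q : q \in M -> None \in q -> grp a \in q -> grp b \in q -> grp c \in q ->
      covered LD a b c.
    move=> qM Nq aq bq cq.
    apply: (@covered_sub _ (derived_blocks (pmap id q))).
      by move=> t tq; apply/flatten_mapP; exists q; rewrite ?mem_filter ?Nq.
    exact: derived_cover (allP M4 q qM) Nq aq bq cq U ng.
  have [Ug|nUg] := boolP (uniq [:: grp a; grp b; grp c]).
    have /coveredP[q qM [aq bq cq]] := Mc _ _ _ Ug.
    have [Nq|Nq] := boolP (None \in q); first by rewrite (derived q).
    apply/orP; right; apply: (@covered_sub _ (zero_sum_blocks (pmap id q))).
      by move=> t tq; apply/flatten_mapP; exists q; rewrite ?mem_filter ?Nq.
    exact: zero_sum_cover (allP M4 q qM) Nq aq bq cq Ug.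
  have two x y : x != y -> all (fun p => grp p \in [:: None; Some x; Some y]) [:: a; b; c] ->
      covered LD a b c.
    move=> xy /allP sub; have /coveredP[q qM [Nq xq yq]] : covered M None (Some x) (Some y).
      by apply: Mc; rewrite uniq3.
    have sq p : p \in [:: a; b; c] -> grp p \in q.
      by move=> /sub; rewrite !inE => /or3P[] /eqP->.
    by apply: (derived q) => //; apply: sq; rewrite !inE eqxx ?orbT.
  apply/orP; left; move: ng nUg two {U derived}; rewrite uniq3.
  case: a b c => [[x i]|a] [[y j]|b] [[z k]|c]; rewrite /one_group //=.
  + case: (eqVneq x y) => [?|xy]; case: (eqVneq x z) => [?|xz];
      case: (eqVneq y z) => [?|yz] => ng H two; subst;
      first [ by rewrite eqxx in ng | by rewrite eqxx in xy | by rewrite eqxx in xz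
            | by rewrite eqxx in yz
            | by apply: (two _ _ xy); rewrite /= !inE /= !eqxx ?orbT
            | by apply: (two _ _ xz); rewrite /= !inE /= !eqxx ?orbT
            | by case/negP: H; apply/and3P; split ].
  + by rewrite !andbT => xy _ two; apply: (two _ _ xy); rewrite /= !inE /= !eqxx ?orbT.
  + by rewrite !andbT => xy _ two; apply: (two _ _ xy); rewrite /= !inE /= !eqxx ?orbT.
  + by move=> xy _ two; apply: (two _ _ xy); rewrite /= !inE /= !eqxx ?orbT.
- have sLD : size LD <= size MN * size L3.
    by apply: size_flatten_leq => q _; rewrite size_map.
  have sLH : size LH <= size MO * #|W| ^ 3.
    apply: size_flatten_leq => q _; by rewrite size_map -cardE !card_prod -!mulnA.
  have sM : size MN + size MO = size M by rewrite !size_filter count_predC.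
  have sMN : 6 * size MN + #|X| <= #|X| ^ 2 by rewrite size_filter.
  rewrite size_cat; move: Mn; rewrite card_option.
  (* d is the surplus of [L3] over |W|^3, and e stands for x(x - 1). The products prepared below
     make the count linear. *)
  have [d dE] : exists d, size L3 = #|W| ^ 3 + d by exists (size L3 - #|W| ^ 3); rewrite subnKC.
  have [e eE] : exists e, #|X| ^ 2 = #|X| + e.
    by exists (#|X| ^ 2 - #|X|); rewrite subnKC // leq_pmulr //; apply/card_gt0P; exists x0.
  move: sMN sLD sLH sM nL3; rewrite eE dE addnC leq_add2l => sMN sLD sLH sM nL3 Mn.
  have P1 := leq_mul Mn (leqnn (#|W| ^ 3)); have P2 := leq_mul sMN (leqnn d).
  have P3 := leq_mul (leqnn e) nL3.
  move: P1 P2 P3 sLD sLH sM eE {sMN nL3 Mn dE}.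
  have E1 := ffact3E (#|X| * #|W| + #|S|).
  have E2 := congr1 (muln e) (ffact3E (3 * #|W| + #|S|)).
  have E3 := ffact3E (#|W| + #|S|); have E4 := congr1 (muln e) E3.
  have E5 := ffact3E #|S|; have E6 := congr1 (muln e) E5.
  have E7 := congr1 (muln #|X|) E3; have E8 := congr1 (muln #|X|) E5.
  have E9 := congr1 (muln (#|W| ^ 3)) (ffact3E #|X|.+1).
  move: E1 E2 E3 E4 E5 E6 E7 E8 E9.
  move: (size LD) (size LH) (size MN) (size MO) (size M) => ld lh mn mo m.
  move: ((#|X| * #|W| + #|S|) ^_ 3) ((3 * #|W| + #|S|) ^_ 3) ((#|W| + #|S|) ^_ 3) (#|S| ^_ 3) (#|X|.+1 ^_ 3).
  move: #|X| #|W| #|S| => x w s f1 f2 f3 f4 f5; rewrite !expnS !expn0 !muln1.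
  move=> E1 E2 E3 E4 E5 E6 E7 E8 E9 P1 P2 P3 sLD sLH sM eE.
  have eE2 := congr1 (muln (w * (w * w) * x)) eE. have eE3 := congr1 (muln (w * (w * w))) eE.
  have eE4 := congr1 (muln (w * (w * s))) eE. have eE5 := congr1 (muln (w * (w * w))) sM.
  have eE6 := congr1 (muln (w * w)) eE.
  lia.
Qed.
End Weighting.


(** * Small ingredients *)

Lemma same_group_sym (G W S : finType) (a b : G * W + S) : same_group a b = same_group b a.
Proof. by case: a b => [[x i]|a] [[y j]|b] //=; rewrite eq_sym. Qed.

Lemma one_group_swap12 (G W S : finType) (a b c : G * W + S) :
  one_group a b c = one_group b a c.
Proof. by rewrite /one_group [same_group b a]same_group_sym; congr (_ && _); rewrite andbC. Qed.

Lemma one_group_swap23 (G W S : finType) (a b c : G * W + S) :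
  one_group a b c = one_group a c b.
Proof. by rewrite /one_group [same_group c b]same_group_sym andbCA. Qed.

(* The point (i, k) of group i is coded by i * w + k, stem points by the codes >= g * w. *)
Section Codes.
Variables g w s : nat.

Definition same_code (x y : nat) :=
  [|| g * w <= x, g * w <= y | x %/ w == y %/ w].

(** Made for evaluation: the list is narrowed before the next point is tried, and increasing triples
    suffice by symmetry. *)
Definition check_cover (L : seq (seq nat)) :=
  all (fun a => let La := [seq q <- L | a \in q] in
    all (fun b => let Lb := [seq q <- La | b \in q] in
      all (fun c => [&& same_code a b, same_code a c & same_code b c]
                    || has (fun q => c \in q) Lb)
          (iota b.+1 (g * w + s - b.+1)))
      (iota a.+1 (g * w + s - a.+1)))
    (iota 0 (g * w + s)).

End Codes.

Section Decode.
Variables g w s : nat.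
Let P : finType := ('I_g.+1 * 'I_w.+1 + 'I_s.+1)%type.

Definition decode (c : nat) : P :=
  if c < g.+1 * w.+1 then inl (inord (c %/ w.+1), inord (c %% w.+1))
  else inr (inord (c - g.+1 * w.+1)).

Definition encode (p : P) : nat :=
  match p with inl (i, k) => i * w.+1 + k | inr k => g.+1 * w.+1 + k end.

Lemma encode_inl_ltn (i : 'I_g.+1) (k : 'I_w.+1) : i * w.+1 + k < g.+1 * w.+1.
Proof. have := ltn_ord i; have := ltn_ord k; nia. Qed.

Lemma encode_ltn p : encode p < g.+1 * w.+1 + s.+1.
Proof.
case: p => [[i k]|k] /=; last by rewrite ltn_add2l.
by apply: leq_trans (encode_inl_ltn i k) (leq_addr _ _).
Qed.

Lemma encodeK : cancel encode decode.
Proof.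
case=> [[i k]|k]; rewrite /decode /=.
  rewrite encode_inl_ltn divnMDl // modnMDl divn_small // modn_small // addn0.
  by rewrite !inord_val.
by rewrite ltnNge leq_addr addKn inord_val.
Qed.

Lemma same_code_encode p q : same_code g.+1 w.+1 (encode p) (encode q) = same_group p q.
Proof.
rewrite /same_code.
case: p q => [[i k]|k] [[i' k']|k'] /=; rewrite ?leq_addr ?orbT // ![_ <= _ + _]leqNgt !encode_inl_ltn /=.
by rewrite !divnMDl // !divn_small // !addn0.
Qed.

Lemma decode_cover (L : seq (seq nat)) : check_cover g.+1 w.+1 s.+1 L ->
  forall a b c, uniq [:: a; b; c] -> ~~ one_group a b c ->
    covered [seq map decode q | q <- L] a b c.
Proof.
move=> chk; apply: (covered_sorted (key := encode)).
- by move=> a b c; rewrite one_group_swap12.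
- by move=> a b c; rewrite one_group_swap23.
move=> a b c U ng /andP[]; rewrite leq_eqVlt [encode b <= _]leq_eqVlt.
rewrite !(inj_eq (can_inj encodeK)).
move: U; rewrite uniq3 => /and3P[/negPf-> _ /negPf->] /= ab bc.
have /allP/(_ (encode a)) := chk; rewrite mem_iota add0n encode_ltn => /(_ isT).
move=> /allP/(_ (encode b)); rewrite mem_iota ab subnKC ?encode_ltn // => /(_ isT).
move=> /allP/(_ (encode c)); rewrite mem_iota bc subnKC ?encode_ltn // => /(_ isT).
rewrite !same_code_encode -/(one_group a b c) (negPf ng) /=.
case/hasP=> q; rewrite !mem_filter => /and3P[bq aq qL] cq.
apply/coveredP; exists (map decode q); first exact: map_f.
by rewrite -[a]encodeK -[b]encodeK -[c]encodeK !map_f.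
Qed.

End Decode.

(* [cqs_w_3_s] covers the triples on three groups of w points and a stem of s points
   that are not inside a group with the stem. *)
Definition cqs_2_3_2 : seq (seq nat) :=
  [:: [:: 0; 2; 4; 6]; [:: 0; 2; 5; 7]; [:: 0; 3; 4; 7]; [:: 0; 3; 5; 6];
      [:: 1; 2; 4; 7]; [:: 1; 2; 5; 6]; [:: 1; 3; 4; 6]; [:: 1; 3; 5; 7];
      [:: 0; 1; 2; 3]; [:: 0; 1; 4; 5]; [:: 2; 3; 4; 5]].

(** An SQS(10) less its three blocks consisting of a group and the stem point: 27 = 30 - 3. The base
    blocks through the stem point 9 have orbits of length 3 under Z_3 x Z_3, the other two of length
    9. *)
Definition cqs_3_3_1 : seq (seq nat) :=
  let turn (p : nat) := if p < 9 then p %/ 3 * 3 + (p %% 3).+1 %% 3 else p in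
  let shift (p : nat) := if p < 9 then (p + 3) %% 9 else p in
  let orbit m q := [seq map (iter r shift \o iter c turn) q | r <- iota 0 m, c <- iota 0 3] in
  flatten [seq orbit 1 q | q <- [:: [:: 0; 3; 6; 9]; [:: 0; 5; 7; 9]; [:: 0; 4; 8; 9]]] ++
  flatten [seq orbit 3 q | q <- [:: [:: 0; 1; 3; 7]; [:: 0; 1; 4; 5]]].

(* Found by computer search among the systems invariant under a group of order 36: the
   translations of Z2 x Z2 x Z3 acting on the points a * 6 + b * 3 + c of all groups (those
   with odd a swap the stem points) and the rotation of the groups. *)
Definition cqs_12_3_2 : seq (seq nat) :=
  let sh3 p := if p < 36 then p - p %% 3 + (p %% 3).+1 %% 3 else p in
  let shb p := if p < 36 then if p %% 6 < 3 then p + 3 else p - 3 else p in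
  let sha p := if p < 36 then if p %% 12 < 6 then p + 6 else p - 6 else 73 - p in
  let rot p := if p < 36 then (p + 12) %% 36 else p in
  let orbit m n q := flatten [seq [seq map (iter rab.1 rot \o iter rab.2 sha \o iter b shb \o iter c sh3) q
     | b <- iota 0 2, c <- iota 0 3] | rab <- [seq (r, a) | r <- iota 0 m, a <- iota 0 n]] in
  flatten [seq orbit 1 2 q | q <- [:: [:: 0; 14; 25; 36]; [:: 0; 12; 24; 37]; [:: 0; 13; 26; 36]]] ++
  flatten [seq orbit 3 1 q | q <- [:: [:: 0; 6; 15; 21]; [:: 0; 6; 13; 19]; [:: 0; 6; 12; 18];
     [:: 0; 9; 12; 21]]] ++
  flatten [seq orbit 3 2 q | q <-
   [::
      [:: 0; 15; 32; 36]; [:: 0; 13; 33; 37]; [:: 0; 14; 31; 37]; [:: 0; 16; 32; 37]; [:: 0; 17; 35; 37];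
      [:: 0; 15; 30; 37]; [:: 0; 12; 29; 36]; [:: 0; 3; 13; 24]; [:: 0; 3; 18; 26]; [:: 0; 3; 30; 34];
      [:: 0; 3; 25; 32]; [:: 0; 1; 25; 28]; [:: 0; 3; 19; 23]; [:: 0; 4; 25; 30]; [:: 0; 1; 12; 17];
      [:: 0; 4; 24; 31]; [:: 0; 4; 14; 20]; [:: 0; 4; 13; 17]; [:: 0; 4; 16; 34]; [:: 0; 4; 19; 33];
      [:: 0; 4; 15; 22]; [:: 0; 4; 12; 23]; [:: 0; 7; 15; 31]; [:: 0; 7; 23; 28]; [:: 0; 1; 15; 18];
      [:: 0; 10; 20; 28]; [:: 0; 1; 27; 31]; [:: 0; 7; 29; 32]; [:: 0; 7; 21; 33]; [:: 0; 7; 26; 35];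
      [:: 0; 6; 14; 22]; [:: 0; 9; 15; 29]; [:: 0; 1; 16; 29]; [:: 0; 6; 17; 28]; [:: 0; 10; 17; 30];
      [:: 0; 10; 18; 31]; [:: 0; 7; 13; 34]; [:: 0; 10; 12; 27]; [:: 0; 10; 19; 24]; [:: 0; 1; 19; 20];
      [:: 0; 7; 19; 30]; [:: 0; 7; 20; 24]; [:: 0; 10; 22; 26]; [:: 0; 1; 13; 14]; [:: 0; 10; 13; 21];
      [:: 0; 1; 22; 33]; [:: 0; 1; 21; 23]; [:: 0; 9; 25; 35]
   ]].

(** Two copies of Z_7 with the symmetries x -> x + 1 and x -> 2x; four orbits of length 7 and three
    of length 21 make the 91 blocks. *)
Definition sqs_14 : seq (seq nat) :=
  let shift p := p %/ 7 * 7 + (p %% 7).+1 %% 7 in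
  let double p := p %/ 7 * 7 + (p %% 7 * 2) %% 7 in
  let orbit m q := [seq map (iter i shift \o iter j double) q | i <- iota 0 7, j <- iota 0 m] in
  flatten [seq orbit 1 q | q <- [:: [:: 7; 8; 9; 12]; [:: 0; 8; 9; 11]; [:: 0; 1; 5; 9]; [:: 0; 1; 2; 4]]] ++
  flatten [seq orbit 3 q | q <- [:: [:: 0; 1; 12; 13]; [:: 0; 1; 7; 8]; [:: 0; 1; 10; 11]]].


Lemma weighting_codes (w s v : nat) (L : seq (seq nat)) : s < 2 -> 0 < v ->
  all (fun q => size q <= 4) L -> check_cover 3 w.+1 s.+1 L ->
  w.+1 ^ 3 <= size L ->
  24 * size L + 3 * (w.+1 + s.+1) ^_ 3 <= (3 * w.+1 + s.+1) ^_ 3 + 2 * s.+1 ^_ 3 ->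
  sqs_exists v.+1 -> sqs_exists (w.+1 + s.+1) -> sqs_exists (v * w.+1 + s.+1).
Proof.
move=> s2 v0 L4 Lc Lw Ln ev ew.
pose L3 := [seq map (@decode 2 w s) q | q <- L].
have := @weighting 'I_v 'I_w.+1 'I_s.+1 L3; rewrite !card_ord; apply=> //.
- exact: all_size_map.
- exact: decode_cover.
- exact: Ordinal v0.
- by rewrite size_map.
- by rewrite size_map.
Qed.

Lemma sqs_exists_2 : sqs_exists 2.
Proof.
have <- : #|'I_2| = 2 by rewrite card_ord.
apply: (@sqs_exists_list _ [::]); split=> // a b c U.
by have := max_card (mem [:: a; b; c]); rewrite (card_uniqP U) card_ord.
Qed.

Lemma sqs_exists_4 : sqs_exists 4.
Proof.
have <- : #|'I_4| = 4 by rewrite card_ord.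
apply: (@sqs_exists_list _ [:: enum 'I_4]); split=> [|a b c U|].
- by rewrite /= size_enum_ord.
- by apply/coveredP; exists (enum 'I_4); rewrite ?mem_head ?mem_enum.
- by rewrite card_ord.
Qed.

(** With thirteen groups of one point and a single stem point, no three distinct points lie in one
    group with the stem, so the group checker tests every triple. *)
Lemma sqs_exists_14 : sqs_exists 14.
Proof.
pose L := [seq map (@decode 12 0 0) q | q <- sqs_14].
have E : #|{: 'I_13 * 'I_1 + 'I_1}| = 14 by rewrite card_sum card_prod !card_ord.
rewrite -E; apply: (@sqs_exists_list _ L); split=> [|a b c U|].
- by apply: all_size_map; vm_compute.
- apply: decode_cover (U) _; first by vm_compute.
  have sg (p q : 'I_13 * 'I_1 + 'I_1) : p != q -> same_group p q -> in_stem p != in_stem q.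
    by case: p q => [[x i]|k] [[y j]|l] //=; rewrite ?[k]ord1 ?[l]ord1 ?[i]ord1 ?[j]ord1 // => /eqP + /eqP => /[swap] ->.
  move: U; rewrite uniq3 => /and3P[/sg ab /sg ac /sg bc].
  by apply/negP=> /and3P[/ab + /ac + /bc]; case: (in_stem a) (in_stem b) (in_stem c) => [] [] [].
- by rewrite size_map E.
Qed.

(** The ingredient is the SQS(8) less three blocks through two common points, 11 = 14 - 3. *)
Lemma sqs_exists_mul2 v : 1 < v -> sqs_exists v -> sqs_exists (2 * v).
Proof.
case: v => [|[|v]] // _ ev.
have -> : 2 * v.+2 = v.+1 * 2 + 2 by lia.
apply: (@weighting_codes 1 1 v.+1 cqs_2_3_2) => //; exact: sqs_exists_4.
Qed.

Lemma sqs_exists_mul3 v : 1 < v -> sqs_exists v -> sqs_exists (3 * v - 2).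
Proof.
case: v => [|[|v]] // _ ev.
have -> : 3 * v.+2 - 2 = v.+1 * 3 + 1 by lia.
by apply: (@weighting_codes 2 0 v.+1 cqs_3_3_1) => //; exact: sqs_exists_4.
Qed.

Lemma check_cqs_12_3_2 : check_cover 3 12 2 cqs_12_3_2.
Proof. by vm_cast_no_check (erefl true). Qed.

(** With an SQS(14) on each group and the stem, the ingredient completes to an SQS(38), the case v =
    4. Hence order 14 has to be known beforehand. *)
Lemma sqs_exists_mul12 v : 1 < v -> sqs_exists v -> sqs_exists (12 * v - 10).
Proof.
case: v => [|[|v]] // _ ev.
have -> : 12 * v.+2 - 10 = v.+1 * 12 + 2 by lia.
have sz : size cqs_12_3_2 = 1836 by vm_compute.
apply: (@weighting_codes 11 1 v.+1 cqs_12_3_2 isT isT _ check_cqs_12_3_2 _ _ ev sqs_exists_14).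
- by vm_compute.
- by rewrite sz.
- by rewrite sz; vm_compute.
Qed.


(** * Tripling *)

Definition linked (T : eqType) (f : seq (T * T)) x y := ((x, y) \in f) || ((y, x) \in f).

Lemma linkedC (T : eqType) (f : seq (T * T)) x y : linked f x y = linked f y x.
Proof. exact: orbC. Qed.

Definition perfect (T : eqType) (f : seq (T * T)) := forall x, exists y, linked f x y.

Lemma ord3P (i : 'I_3) : [\/ i = 0%R, i = 1%R | i = (-1)%R].
Proof.
by case: i => [[|[|[|]]]] // lt_i; [constructor 1|constructor 2|constructor 3]; apply: val_inj.
Qed.

Section Tripling.
Variables (W : finComNzRingType) (S : finType) (h n : nat).
Variable J : seq ('I_3 * W * W).
Variable tau : S -> W.
Variable F : seq (seq (W * W)).
Hypothesis J_size : size J <= 3 * h.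
Hypothesis F_size : size F + 1 + 2 * h <= #|W|.
Hypothesis F_half : forall f, f \in F -> size f <= n.
Hypothesis F_perfect : forall f, f \in F -> perfect f.
Hypothesis W_size : #|W| = 2 * n /\ #|W| = 6 * h + #|S|.
Hypothesis sums : forall u, (exists s, u = tau s) \/
  (exists i j j', [/\ (i, j, j') \in J \/ (i, j', j) \in J & u = j]).
Hypothesis pairs : forall x y, x != y -> (exists2 f, f \in F & linked f x y) \/
  (forall i, exists j j', [/\ (i, j, j') \in J \/ (i, j', j) \in J & (y - x = j' - j)%R]).

Local Notation P := ('I_3 * W + S)%type.

Definition stem_block (t : S * W * W) : seq P :=
  [:: inr t.1.1; inl (0, t.1.2); inl (1, t.2); inl (-1, tau t.1.1 - t.1.2 - t.2)]%R.

(* The transversal (x, y, z) with x + y + z = j shares a block with the point that replaces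
   its element of group i and changes the sum to the partner j' of j. *)
Definition sum_block (t : ('I_3 * W * W) * (W * W)) : seq P :=
  [:: inl (t.1.1.1, t.1.1.2 - t.2.1 - t.2.2); inl (t.1.1.1, t.1.2 - t.2.1 - t.2.2);
      inl (t.1.1.1 + 1, t.2.1); inl (t.1.1.1 - 1, t.2.2)]%R.

Definition cross_block (ik : 'I_3 * 'I_3) (e : (W * W) * (W * W)) : seq P :=
  [:: inl (ik.1, e.1.1); inl (ik.1, e.1.2); inl (ik.2, e.2.1); inl (ik.2, e.2.2)].

(** A triple across the three groups is served according to its sum: by a stem point if the sum is
    in the image of [tau], else by a pair of sums in [J]. The h pairs of sums of a group also use up
    2h one-factors' worth of pairs inside it, so that 2n - 1 - 2h one-factors are left to [F]. *)
Definition tripling_blocks :=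
  [seq stem_block t | t <- enum {: S * W * W}] ++
  [seq sum_block (t, zw) | t <- J, zw <- enum {: W * W}] ++
  flatten [seq [seq cross_block ik (e, e') | e <- f, e' <- f] |
             ik <- [:: (0, 1); (0, -1); (1, -1)]%R, f <- F].

Local Notation L := tripling_blocks.

Lemma stem_blockP t a b c :
  a \in stem_block t -> b \in stem_block t -> c \in stem_block t -> covered L a b c.
Proof.
move=> ha hb hc; apply/coveredP; exists (stem_block t) => //.
by rewrite mem_cat map_f ?mem_enum.
Qed.

Lemma sum_blockP i j j' z w a b c : (i, j, j') \in J \/ (i, j', j) \in J ->
  let q := [:: inl (i, j - z - w); inl (i, j' - z - w); inl (i + 1, z); inl (i - 1, w)]%R in
  a \in q -> b \in q -> c \in q -> covered L a b c.
Proof.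
move=> iJ q; have [t tL qt] : exists2 t, sum_block t \in L & q =i sum_block t.
  case: iJ => iJ; [exists (i, j, j', (z, w)) | exists (i, j', j, (z, w))] => //.
  - by rewrite !mem_cat (allpairs_f (fun t zw => sum_block (t, zw))) ?orbT // mem_enum.
  - by rewrite !mem_cat (allpairs_f (fun t zw => sum_block (t, zw))) ?orbT // mem_enum.
  - by move=> p; rewrite !inE orbCA.
by rewrite !qt => ? ? ?; apply/coveredP; exists (sum_block t).
Qed.

Lemma cross_blockP i k f x y z t : i != k -> f \in F -> linked f x y -> linked f z t ->
  covered L (inl (i, x)) (inl (i, y)) (inl (k, z)).
Proof.
move=> ik fF xy zt.
have [e ef he] : exists2 e, e \in f & (e = (x, y)) \/ (e = (y, x)).
  by case/orP: xy; [exists (x, y) | exists (y, x)] => //; [left | right].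
have [e' ef' he'] : exists2 e, e \in f & (e = (z, t)) \/ (e = (t, z)).
  by case/orP: zt; [exists (z, t) | exists (t, z)] => //; [left | right].
have cb ik' d d' : ik' \in [:: (0, 1); (0, -1); (1, -1)]%R -> d \in f -> d' \in f -> cross_block ik' (d, d') \in L.
  move=> ikl df df'; rewrite !mem_cat; apply/orP; right; apply/orP; right.
  apply/flattenP; exists [seq cross_block ik' (e, e') | e <- f, e' <- f].
    exact: (allpairs_f (fun ik f => [seq cross_block ik (e, e') | e <- f, e' <- f])).
  exact: (allpairs_f (fun e e' => cross_block ik' (e, e'))).
have [ikl|kil] : (i, k) \in [:: (0, 1); (0, -1); (1, -1)]%R \/ (k, i) \in [:: (0, 1); (0, -1); (1, -1)]%R.
  by case: (ord3P i) ik => ->; case: (ord3P k) => -> //; rewrite ?eqxx //; [left|left|right|left|right|right].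
- apply/coveredP; exists (cross_block (i, k) (e, e')); first exact: cb.
  by case: he => ->; case: he' => ->; rewrite !inE !eqxx ?orbT.
- apply/coveredP; exists (cross_block (k, i) (e', e)); first exact: cb.
  by case: he => ->; case: he' => ->; rewrite !inE !eqxx ?orbT.
Qed.

Lemma tripling_pair i k x y z : i != k -> x != y ->
  covered L (inl (i, x)) (inl (i, y)) (inl (k, z)).
Proof.
move=> ik /pairs[[f fF xy]|/(_ i)[j [j' [iJ dxy]]]].
  by have [t zt] := F_perfect fF z; exact: cross_blockP zt.
have [ek|ek] : k = (i + 1)%R \/ k = (i - 1)%R.
- by case: (ord3P i) ik => ->; case: (ord3P k) => -> // _; [left|right|right|left|left|right]; apply: val_inj.
(* The last coordinate j - x - z of the sum block is forced by x and z. *)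
- have ex : x = (j - z - (j - x - z))%R by ring.
  have ey : y = (j' - z - (j - x - z))%R by rewrite -[LHS](subrK x) dxy; ring.
  apply: (sum_blockP (z := z) (w := (j - x - z)%R) iJ); rewrite !inE ?ek.
  + by rewrite -ex eqxx.
  + by rewrite -ey eqxx orbT.
  + by rewrite eqxx !orbT.
- have ex : x = (j - (j - x - z) - z)%R by ring.
  have ey : y = (j' - (j - x - z) - z)%R by rewrite -[LHS](subrK x) dxy; ring.
  apply: (sum_blockP (z := (j - x - z)%R) (w := z) iJ); rewrite !inE ?ek.
  + by rewrite -ex eqxx.
  + by rewrite -ey eqxx orbT.
  + by rewrite eqxx !orbT.
Qed.

Lemma tripling_stem s i k x y : i != k ->
  covered L (inr s) (inl (i, x)) (inl (k, y)).
Proof.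
have sol a b : (tau s - a - (tau s - a - b) = b)%R by ring.
have sol' a b : (tau s - (tau s - a - b) - b = a)%R by ring.
case: (ord3P i) => ->; case: (ord3P k) => -> // _.
- by apply: (stem_blockP (t := (s, x, y))); rewrite !inE !eqxx ?orbT.
- by apply: (stem_blockP (t := (s, x, tau s - x - y)%R)); rewrite !inE /= ?sol !eqxx ?orbT.
- by apply: (stem_blockP (t := (s, y, x))); rewrite !inE !eqxx ?orbT.
- by apply: (stem_blockP (t := (s, tau s - y - x, x)%R)); rewrite !inE /= ?sol' !eqxx ?orbT.
- by apply: (stem_blockP (t := (s, y, tau s - y - x)%R)); rewrite !inE /= ?sol !eqxx ?orbT.
- by apply: (stem_blockP (t := (s, tau s - x - y, y)%R)); rewrite !inE /= ?sol' !eqxx ?orbT.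
Qed.

Lemma tripling_trans x y z : covered L (inl (0, x)%R) (inl (1, y)%R) (inl (-1, z)%R).
Proof.
have [[s es]|[i [j [j' [iJ ej]]]]] := sums (x + y + z)%R.
  have e : (tau s - x - y = z)%R by rewrite -es; ring.
  by apply: (stem_blockP (t := (s, x, y))); rewrite !inE /= ?e ?eqxx ?orbT.
have [ei|ei|ei] := ord3P i; subst i.
- apply: (sum_blockP (z := y) (w := z) iJ); rewrite !inE -ej.
  + by rewrite (_ : _ - _ - _ = x)%R ?eqxx //; ring.
  + by rewrite !add0r eqxx !orbT.
  + by rewrite !add0r eqxx !orbT.
- apply: (sum_blockP (z := z) (w := x) iJ); rewrite !inE -ej.
  + by rewrite ?subrr ?addrK ?subrK eqxx !orbT.
  + by rewrite (_ : _ - _ - _ = y)%R ?eqxx //; ring.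
  + by rewrite (_ : 1 + 1 = -1)%R ?eqxx ?orbT //; apply: val_inj.
- apply: (sum_blockP (z := x) (w := y) iJ); rewrite !inE -ej.
  + by rewrite !addNr eqxx !orbT.
  + by rewrite (_ : -1 - 1 = 1)%R ?eqxx ?orbT //; apply: val_inj.
  + by rewrite (_ : _ - _ - _ = z)%R ?eqxx //; ring.
Qed.

Lemma tripling_cover a b c : uniq [:: a; b; c] -> ~~ one_group a b c -> covered L a b c.
Proof.
have S12 := @covered_swap12 P L; have S23 := @covered_swap23 P L.
have trans i j k x y z : uniq [:: i; j; k] -> covered L (inl (i, x)) (inl (j, y)) (inl (k, z)).
  rewrite uniq3; case: (ord3P i) => ->; case: (ord3P j) => ->; case: (ord3P k) => -> // _.
  - exact: tripling_trans.
  - by rewrite S23 tripling_trans.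
  - by rewrite S12 tripling_trans.
  - by rewrite S23 S12 tripling_trans.
  - by rewrite S12 S23 tripling_trans.
  - by rewrite S12 S23 S12 tripling_trans.
case: a b c => [[i x]|a] [[j y]|b] [[k z]|c]; rewrite uniq3 /one_group //= => U.
- case: (eqVneq i j) U => [<-|ij] U; case: (eqVneq i k) U => [<-|ik] U; rewrite ?eqxx //= => ng.
  + by apply: tripling_pair ik _; case/and3P: U => /eqP xy _ _; apply/eqP => exy; apply: xy; rewrite exy.
  + rewrite S23; apply: tripling_pair ij _.
    by case/and3P: U => _ /eqP xz _; apply/eqP => exz; apply: xz; rewrite exz.
  + have [ejk|jk] := eqVneq j k; last by apply: trans; rewrite uniq3 ij ik.
    subst k; rewrite S12 S23; apply: tripling_pair; first by rewrite eq_sym.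
    by case/and3P: U => _ _ /eqP yz; apply/eqP => eyz; apply: yz; rewrite eyz.
- by rewrite andbT => ij; rewrite S23 S12 tripling_stem.
- by rewrite andbT => ij; rewrite S12 tripling_stem.
- by move=> ij; rewrite tripling_stem.
Qed.

Lemma tripling : (#|S| <= 2) || (#|S| == 4) -> sqs_exists (#|W| + #|S|) ->
  sqs_exists (3 * #|W| + #|S|).
Proof.
move=> Sle eWS; have [Wn Wh] := W_size.
rewrite -[3]card_ord; apply: (fill_groups (L := L)) => //; last by rewrite card_ord.
- rewrite !all_cat; apply/and3P; split; apply/allP => q.
  + by case/mapP=> ? _ ->.
  + by case/allpairsP=> ? [_ _ ->].
  + by case/flattenP=> ? /allpairsP[? [_ _ ->]] /allpairsP[? [_ _ ->]].
- exact: tripling_cover.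
- have szF : size (flatten [seq [seq cross_block ik (e, e') | e <- f, e' <- f] |
             ik <- [:: (0, 1); (0, -1); (1, -1)]%R, f <- F]) <= 3 * size F * (n * n).
    rewrite -[X in flatten X]map_id; apply: leq_trans (size_flatten_leq (k := n * n) _) _.
      move=> _ /allpairsP[[ik f] [_ /= /F_half fn ->]].
      by rewrite size_allpairs leq_mul.
    by rewrite size_allpairs.
  move: szF; set LF := flatten _; rewrite !size_cat size_map size_allpairs -!cardE !card_prod card_ord.
  have := ffact3E (3 * #|W| + #|S|); have := ffact3E (#|W| + #|S|); have := ffact3E #|S|.
  move: ((3 * #|W| + #|S|) ^_ 3) ((#|W| + #|S|) ^_ 3) (#|S| ^_ 3).
  move: J_size F_size Wn Wh.
  move: #|W| #|S| (size J) (size F) (size LF) => w s j f l Jh Fh wn wh f1 f2 f3.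
  rewrite !expnS !expn0 !muln1 => E1 E2 E3 szF.
  have P1 := leq_mul Jh (leqnn (w * w)); have P2 := leq_mul Fh (leqnn (n * n)).
  subst w.
  have Q1 := congr1 (muln (n * n)) wh.
  have Q2 := congr1 (muln (n * s)) wh.
  have Q3 := congr1 (muln n) wh.
  have Q4 := congr1 (muln (s * s)) wh.
  lia.
Qed.

End Tripling.


(** * One-factorizations of complete graphs by the round robin *)

Definition one_factorization (T : eqType) (m : nat) (F : seq (seq (T * T))) :=
  [/\ size F = m.*2.-1, forall f, f \in F -> size f <= m,
      forall f, f \in F -> perfect f
    & forall x y, x != y -> exists2 f, f \in F & linked f x y].

Lemma linked_map (T U : eqType) (p : T -> U) (f : seq (T * T)) x y :
  linked f x y -> linked [seq (p e.1, p e.2) | e <- f] (p x) (p y).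
Proof.
by case/orP=> H; apply/orP; [left | right]; rewrite (map_f (fun e => (p e.1, p e.2)) H).
Qed.

Lemma linked_cat (T : eqType) (f1 f2 : seq (T * T)) x y :
  linked (f1 ++ f2) x y = linked f1 x y || linked f2 x y.
Proof. by rewrite /linked !mem_cat orbACA. Qed.

Section RoundRobin.
Variable k : nat.
Local Notation Z := 'I_(k.*2).+1.

Definition spokes (c : Z) : seq (Z * Z) :=
  [seq (c + inord i, c - inord i)%R | i <- iota 1 k].

Lemma inord_opp (d : Z) : 0 < d -> inord (k.*2.+1 - d) = (- d)%R.
Proof.
move=> d0; have dlt := ltn_ord d; apply: val_inj; rewrite /= inordK; last by lia.
by rewrite modn_small //; lia.
Qed.

Lemma spokes_linked c x : x != c -> linked (spokes c) x (c + c - x)%R.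
Proof.
rewrite -subr_eq0 => xc; pose d := (x - c)%R.
have dE e : (x = c + e -> c + c - x = c - e)%R by move=> ->; rewrite opprD addrA addrK.
have [dk|dk] := leqP d k.
  have ex : x = (c + inord d)%R by rewrite inord_val addrC subrK.
  apply/orP; left; apply/mapP; exists (val d).
    by rewrite mem_iota lt0n add1n ltnS dk xc.
  by rewrite (dE (inord d)) // -ex.
have ex : x = (c - inord (k.*2.+1 - d))%R.
  rewrite inord_opp; last by lia.
  by rewrite opprK addrC subrK.
apply/orP; right; apply/mapP; exists (k.*2.+1 - d).
  by rewrite mem_iota; have := ltn_ord d; lia.
by rewrite (dE (- inord (k.*2.+1 - d))%R) // opprK -ex.
Qed.

Lemma spokes_exists x y : x != y -> exists c, linked (spokes c) x y.
Proof.
(* k + 1 is the inverse of 2 modulo 2k + 1, so [c] is the midpoint of x and y. *)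
move=> xy; pose c := ((x + y) *+ k.+1)%R.
have cc : (c + c - x = y)%R.
  have -> : (c + c = x + y)%R.
    rewrite -mulrnDr; have -> : (k.+1 + k.+1 = (k.*2).+1 + 1)%N by lia.
    rewrite mulrnDr mulr1n -[RHS]add0r; congr (_ + _)%R.
    by rewrite Zp_mulrn; apply: val_inj; rewrite /= modnMl.
  by rewrite addrAC subrr add0r.
exists c; rewrite -cc; apply: spokes_linked.
by apply: contra xy => /eqP xc; rewrite -cc -xc addrK.
Qed.

Definition round (c : Z) : seq (option Z * option Z) :=
  (None, Some c) :: [seq (Some e.1, Some e.2) | e <- spokes c].

Lemma round_linked c x y : linked (spokes c) x y -> linked (round c) (Some x) (Some y).
Proof.
by move=> l; rewrite /round -cat1s linked_cat (linked_map Some l) orbT.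
Qed.

Lemma round_robin : one_factorization k.+1 [seq round c | c <- enum {: Z}].
Proof.
split.
- by rewrite size_map -cardE card_ord.
- by move=> _ /mapP[c _ ->]; rewrite /= !size_map size_iota.
- move=> _ /mapP[c _ ->] [x|]; last by exists (Some c); rewrite /linked mem_head.
  have [->|xc] := eqVneq x c; first by exists None; rewrite /linked mem_head orbT.
  by exists (Some (c + c - x)%R); apply/round_linked/spokes_linked.
have memr c : round c \in [seq round c | c <- enum {: Z}] by rewrite map_f ?mem_enum.
move=> [x|] [y|] // xy; last 2 first.
- by exists (round x); rewrite // /linked mem_head orbT.
- by exists (round y); rewrite // /linked mem_head.
by have [//|c l] := @spokes_exists x y; exists (round c); rewrite ?round_linked.
Qed.

End RoundRobin.

Lemma one_factorization_exists (T : finType) m : #|T| = m.*2 -> 0 < m ->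
  exists F : seq (seq (T * T)), one_factorization m F.
Proof.
case: m => // k Tk _; have [F1 F2 F3 F4] := round_robin k.
have [|p pb] := @card_bij (option 'I_(k.*2).+1) T; first by rewrite card_option card_ord Tk.
have [q pK qK] := pb.
exists [seq [seq (p e.1, p e.2) | e <- f] | f <- [seq round c | c <- enum {: 'I_(k.*2).+1}]]; split.
- by rewrite size_map.
- by move=> _ /mapP[f /F2 + ->]; rewrite size_map.
- move=> _ /mapP[f /F3 pf ->] x; have [y xy] := pf (q x).
  by exists (p y); rewrite -[x]qK; apply: linked_map.
move=> x y xy; have [|f fF l] := F4 (q x) (q y); first by rewrite (can_eq qK).
by exists [seq (p e.1, p e.2) | e <- f]; rewrite ?map_f // -[x]qK -[y]qK; apply: linked_map.
Qed.

(** * Tripling over the integers modulo 2n *)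

Section TriplingInstance.
Variables h n s : nat.
Hypothesis n0 : 0 < n.
Hypothesis h0 : 0 < h.
Hypothesis nhs : 2 * n = 6 * h + s.
Local Notation W := 'Z_(2 * n).

Lemma twon_gt1 : 1 < 2 * n.
Proof using n0. clear -n0; lia. Qed.

Lemma val_natr k : nat_of_ord (k%:R : W)%R = k %% (2 * n).
Proof. by rewrite val_Zp_nat // twon_gt1. Qed.

Lemma val_lt (u : W) : nat_of_ord u < 2 * n.
Proof. by rewrite -[ltnRHS](Zp_cast twon_gt1) ltn_ord. Qed.

Lemma natr_val (u : W) : ((nat_of_ord u)%:R = u)%R.
Proof. by apply: ord_inj; rewrite val_natr modn_small // val_lt. Qed.

Lemma natr_2n : ((2 * n)%:R = 0 :> W)%R.
Proof. by apply: ord_inj; rewrite val_natr modnn. Qed.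

Lemma natr_2n_sub k : k <= 2 * n -> ((2 * n - k)%:R = - k%:R :> W)%R.
Proof. by move=> kn; rewrite natrB // natr_2n sub0r. Qed.

(** Edges of odd difference d leaving the even points. For d other than n, the pairs of difference d
    up to sign split into two such one-factors, one for d and one for 2n - d. *)
Definition odd_shift m : seq (W * W) :=
  [seq ((2 * a)%:R, (2 * a + (2 * m + 1))%:R)%R | a <- iota 0 n].

Lemma odd_shift_link m (x : W) : ~~ odd (nat_of_ord x) ->
  linked (odd_shift m) x (x + (2 * m + 1)%:R)%R.
Proof.
move=> xe; apply/orP; left; apply/mapP; exists (nat_of_ord x)./2.
  by rewrite mem_iota; have := val_lt x; lia.
have e : 2 * (nat_of_ord x)./2 = nat_of_ord x by lia.
by rewrite [in RHS]natrD e natr_val.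
Qed.

Lemma odd_add (x y : W) : odd (nat_of_ord (x + y)%R) = odd (nat_of_ord x) (+) odd (nat_of_ord y).
Proof.
rewrite -{1}[x]natr_val -{1}[y]natr_val -natrD val_natr -oddD odd_mod //.
by rewrite oddM.
Qed.

Lemma odd_opp (x : W) : odd (nat_of_ord (- x)%R) = odd (nat_of_ord x).
Proof.
have := odd_add x (- x)%R; rewrite subrr /=; by case: (odd _); case: (odd _).
Qed.

Lemma odd_shift_perfect m : perfect (odd_shift m).
Proof.
move=> x; have [xo|xe] := boolP (odd (nat_of_ord x)); last by eexists; apply: odd_shift_link.
exists (x - (2 * m + 1)%:R)%R; rewrite linkedC -{2}[x](subrK (2 * m + 1)%:R%R).
apply: odd_shift_link; rewrite odd_add odd_opp xo val_natr.
have := divn_eq (2 * m + 1) (2 * n); move: (_ %/ _) (_ %% _) => q r; lia.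
Qed.

(** Group i takes the sums from 2hi to 2h(i + 1) - 1 and pairs them symmetrically about the middle.
    The differences are 1, 3, ..., 2h - 1 in each group, as one [F] must serve all three. *)
Definition sum_pairs : seq ('I_3 * W * W) :=
  [seq (i, (2 * h * nat_of_ord i + m)%:R, (2 * h * nat_of_ord i + (2 * h - 1 - m))%:R)%R
     | i <- enum {: 'I_3}, m <- iota 0 h].

Lemma sum_pairsP (i : 'I_3) m : m < h ->
  (i, (2 * h * nat_of_ord i + m)%:R, (2 * h * nat_of_ord i + (2 * h - 1 - m))%:R)%R \in sum_pairs.
Proof.
move=> mh; apply: (allpairs_f (fun (i : 'I_3) m =>
  (i, (2 * h * nat_of_ord i + m)%:R, (2 * h * nat_of_ord i + (2 * h - 1 - m))%:R)%R)).
  by rewrite mem_enum.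
by rewrite mem_iota.
Qed.

Definition stem_sum (k : 'I_s) : W := (6 * h + k)%:R%R.

Lemma sums_covered (u : W) : (exists k, u = stem_sum k) \/
  (exists i j j', [/\ (i, j, j') \in sum_pairs \/ (i, j', j) \in sum_pairs & u = j]).
Proof.
have [u6|u6] := leqP (6 * h) (nat_of_ord u).
  have us : nat_of_ord u - 6 * h < s by have := val_lt u; lia.
  by left; exists (Ordinal us); rewrite /stem_sum /= subnKC // natr_val.
right; have u3 : nat_of_ord u %/ (2 * h) < 3 by rewrite ltn_divLR; lia.
pose i := Ordinal u3; have := divn_eq (nat_of_ord u) (2 * h).
have : nat_of_ord u %% (2 * h) < 2 * h by rewrite ltn_mod; lia.
rewrite -[nat_of_ord u %/ _]/(nat_of_ord i); move: (_ %% _) => r r2 ur.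
have eu : u = ((2 * h * nat_of_ord i + r)%:R)%R by rewrite -[LHS]natr_val; congr (_%:R)%R; lia.
have [rh|rh] := leqP h r; last first.
  by do 3! eexists; split; [left; apply: (sum_pairsP i rh) | exact: eu].
have rh' : 2 * h - 1 - r < h by lia.
do 3! eexists; split; [right; apply: (sum_pairsP i rh') | rewrite eu].
by congr (_%:R)%R; lia.
Qed.

(* In each of the three groups the pairs not met by [sum_pairs] are those whose
   difference is even or lies between 2h+1 and 2n-2h-1. *)
Lemma pairs_covered (F : seq (seq (W * W))) :
  (forall x y, x != y -> ~~ odd (nat_of_ord (y - x)%R) -> exists2 f, f \in F & linked f x y) ->
  (forall m x, h <= m < n - h -> ~~ odd (nat_of_ord x) ->
     exists2 f, f \in F & linked f x (x + (2 * m + 1)%:R)%R) ->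
  forall x y, x != y -> (exists2 f, f \in F & linked f x y) \/
  (forall i, exists j j', [/\ (i, j, j') \in sum_pairs \/ (i, j', j) \in sum_pairs
     & (y - x = j' - j)%R]).
Proof.
move=> Fe Fo x y xy; have [do_|] := boolP (odd (nat_of_ord (y - x)%R)); last by left; exact: Fe.
pose d := nat_of_ord (y - x)%R; have dl : d < 2 * n := val_lt _.
have ed : (y - x = d%:R)%R by rewrite natr_val.
have d2 : d = 2 * d./2 + 1 by rewrite -/d in do_; lia.
have diff (i : 'I_3) m : m < h ->
   (((2 * h * nat_of_ord i + (2 * h - 1 - m))%:R - (2 * h * nat_of_ord i + m)%:R)%R : W) = (2 * h - 1 - 2 * m)%:R%R.
  move=> mh; rewrite -natrB; last by lia.
  by congr (_%:R)%R; lia.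
have [dh|dh] := ltnP d (2 * h).
  right=> i; have mh : (2 * h - 1 - d)./2 < h by lia.
  do 2! eexists; split; [left; apply: (sum_pairsP i mh) | rewrite diff // ed].
  by congr (_%:R)%R; lia.
have [dn|dn] := ltnP d (2 * n - 2 * h); last first.
  right=> i; have mh : (2 * h - 1 - (2 * n - d))./2 < h by lia.
  do 2! eexists; split; [right; apply: (sum_pairsP i mh) | rewrite -[RHS]opprB diff // ed].
  by rewrite -[LHS]opprK -natr_2n_sub; [congr (- _%:R)%R; lia | lia].
left; have [xo|xe] := boolP (odd (nat_of_ord x)); last first.
  have [||f fF] := Fo d./2 x; [lia | exact: xe|].
  by rewrite -d2 -ed addrC subrK; exists f.
have ye : ~~ odd (nat_of_ord y) by rewrite -[y](subrK x) odd_add do_ xo.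
have [||f fF] := Fo (n - 1 - d./2) y; [lia | exact: ye|].
have -> : 2 * (n - 1 - d./2) + 1 = 2 * n - d by lia.
by rewrite natr_2n_sub 1?ltnW // -ed opprB addrC subrK linkedC; exists f.
Qed.

(** [E] must provide the even differences; [ms] names the odd differences 2m + 1 that are left to
    [odd_shift]. *)
Lemma tripling_from (E : seq (seq (W * W))) (ms : seq nat) :
  (s <= 2) || (s == 4) -> sqs_exists (2 * n + s) ->
  size E + size ms + 1 + 2 * h <= 2 * n ->
  (forall f, f \in E -> size f <= n) -> (forall f, f \in E -> perfect f) ->
  (forall x y, x != y -> ~~ odd (nat_of_ord (y - x)%R) -> exists2 f, f \in E & linked f x y) ->
  (forall m x, h <= m < n - h -> m \notin ms -> ~~ odd (nat_of_ord x) ->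
     exists2 f, f \in E & linked f x (x + (2 * m + 1)%:R)%R) ->
  sqs_exists (3 * (2 * n) + s).
Proof.
move=> Ss ens szE En Ep Ee Em.
pose F := E ++ [seq odd_shift m | m <- ms].
have cW : #|{: W}| = 2 * n by rewrite card_ord Zp_cast // twon_gt1.
have := @tripling W 'I_s h n sum_pairs stem_sum F; rewrite cW card_ord; apply=> //.
- by rewrite size_allpairs -cardE card_ord size_iota.
- by rewrite size_cat size_map.
- by move=> f; rewrite mem_cat => /orP[/En //|/mapP[m _ ->]]; rewrite size_map size_iota.
- by move=> f; rewrite mem_cat => /orP[/Ep //|/mapP[m _ ->]]; exact: odd_shift_perfect.
- exact: sums_covered.
apply: pairs_covered => [x y xy /(Ee x y xy)[f fE l]|m x mh xe].
  by exists f; rewrite // mem_cat fE.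
have [mm|mm] := boolP (m \in ms).
  by exists (odd_shift m); [rewrite mem_cat map_f ?orbT | exact: odd_shift_link].
by have [f fE l] := Em m x mh mm xe; exists f; rewrite // mem_cat fE.
Qed.

Lemma even_dist (x y : W) : x != y -> ~~ odd (nat_of_ord (y - x)%R) ->
  exists2 t, 0 < t < n & (y = x + (2 * t)%:R)%R.
Proof.
move=> xy e; exists (nat_of_ord (y - x)%R)./2; last first.
  have -> : 2 * (nat_of_ord (y - x)%R)./2 = nat_of_ord (y - x)%R by lia.
  by rewrite natr_val addrC subrK.
have := val_lt (y - x)%R; suff : 0 < nat_of_ord (y - x)%R by lia.
by rewrite lt0n -[0]/(nat_of_ord (0 : W)%R) (inj_eq (@ord_inj _)) subr_eq0 eq_sym.
Qed.

Lemma double_of (x : W) : exists a : 'I_n, x = (2 * a + odd (nat_of_ord x))%:R%R.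
Proof.
have xn : (nat_of_ord x)./2 < n by have := val_lt x; lia.
by exists (Ordinal xn); rewrite -[LHS]natr_val; congr (_%:R)%R => /=; lia.
Qed.

(** The even and the odd points each carry a complete graph of even order n. This gives n - 1
    one-factors of even differences, and n - 2h odd shifts complete them to 2n - 1 - 2h. *)
Lemma tripling_even : (s <= 2) || (s == 4) -> sqs_exists (2 * n + s) ->
  ~~ odd n -> sqs_exists (3 * (2 * n) + s).
Proof.
move=> Ss ens en.
have [F [F1 F2 F3 F4]] : exists F : seq (seq ('I_n * 'I_n)), one_factorization n./2 F.
  by apply: one_factorization_exists; rewrite ?card_ord; lia.
pose dbl (b : bool) (a : 'I_n) : W := (2 * a + b)%:R%R.
pose lift f : seq (W * W) := [seq (dbl false e.1, dbl false e.2) | e <- f]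
   ++ [seq (dbl true e.1, dbl true e.2) | e <- f].
have liftP f b a a' : linked f a a' -> linked (lift f) (dbl b a) (dbl b a').
  by move=> l; rewrite linked_cat; apply/orP; case: b; [right; exact: (linked_map (dbl true)) | left; exact: (linked_map (dbl false))].
apply: (@tripling_from [seq lift f | f <- F] (iota h (n - 2 * h))) => //.
- by rewrite size_map F1 size_iota; lia.
- by move=> _ /mapP[f /F2 fn ->]; rewrite size_cat !size_map; apply: leq_trans (leq_add fn fn) _; lia.
- move=> _ /mapP[f /F3 pf ->] x; have [a ->] := double_of x.
  by have [a' aa'] := pf a; exists (dbl (odd (nat_of_ord x)) a'); exact: liftP.
- move=> x y xy exy; have [a ea] := double_of x; have [b eb] := double_of y.
  have oxy : odd (nat_of_ord x) = odd (nat_of_ord y).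
    by move: exy; rewrite odd_add odd_opp; case: (odd _); case: (odd _).
  have [|f fF l] := F4 a b; first by apply: contra xy => /eqP ab; rewrite ea eb oxy ab.
  by exists (lift f); [exact: map_f | rewrite ea eb oxy; exact: liftP].
- by move=> m x mh; rewrite mem_iota; lia.
Qed.

(** Even differences alone form two complete graphs of odd order n, which have no one-factor. The
    odd difference n is added to them: the reflection about c pairs c + t with c - t, and its fixed
    points c and c + n are joined. So n = 2 * n./2 + 1 leaves the list of odd shifts. *)
Lemma tripling_odd : (s <= 2) || (s == 4) -> sqs_exists (2 * n + s) ->
  odd n -> sqs_exists (3 * (2 * n) + s).
Proof.
move=> Ss ens on.
pose rot c : seq (W * W) := (c%:R, c%:R + n%:R)%R ::
   [seq (c%:R + t%:R, c%:R - t%:R)%R | t <- iota 1 n.-1].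
have nn : (n%:R + n%:R = 0 :> W)%R by rewrite -natrD addnn -mul2n natr_2n.
have memr c : c < n -> rot c \in [seq rot c | c <- iota 0 n] by move=> cn; rewrite map_f ?mem_iota.
have rotP c t : 0 < t < n -> linked (rot c) (c%:R + t%:R)%R (c%:R - t%:R)%R.
  move=> tn; apply/orP; left; rewrite inE; apply/orP; right.
  by apply/mapP; exists t; rewrite // mem_iota; lia.
have rung c : linked (rot c) c%:R%R (c%:R + n%:R)%R by rewrite /linked mem_head.
have low (x : W) : n <= nat_of_ord x -> (x = (nat_of_ord x - n)%:R + n%:R)%R.
  by move=> nx; rewrite -natrD subnK // natr_val.
apply: (@tripling_from [seq rot c | c <- iota 0 n] [seq m <- iota h (n - 2 * h) | m != n./2]) => //.
- rewrite size_map size_iota size_filter.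
  have := count_predC (pred1 n./2) (iota h (n - 2 * h)).
  have mid : n./2 \in iota h (n - 2 * h) by rewrite mem_iota; lia.
  rewrite count_uniq_mem ?iota_uniq // mid size_iota -[X in _ + X]/(count (fun m => m != n./2) _).
  by move: (count _ _) => k; lia.
- by move=> _ /mapP[c _ ->]; rewrite /= size_map size_iota; lia.
- move=> _ /mapP[c _ ->] x; pose d := nat_of_ord (x - c%:R)%R.
  have ex : (x = c%:R + d%:R)%R by rewrite natr_val addrC subrK.
  have dn : d < 2 * n := val_lt _.
  have [d0|d0] := posnP d; first by exists (c%:R + n%:R)%R; rewrite ex d0 addr0.
  have [dn1|dn1] := ltnP d n; first by exists (c%:R - d%:R)%R; rewrite ex; apply: rotP; rewrite d0.
  have [dn2|dn2] := eqVneq d n; first by exists c%:R%R; rewrite ex dn2 linkedC.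
  exists (c%:R + (2 * n - d)%:R)%R; rewrite linkedC.
  have -> : (x = c%:R - (2 * n - d)%:R)%R by rewrite natr_2n_sub 1?ltnW // opprK.
  by apply: rotP; lia.
- move=> x y xy /(even_dist xy)[t tn ->].
  have [cn|cn] := ltnP (nat_of_ord (x + t%:R)%R) n.
    exists (rot (nat_of_ord (x + t%:R)%R)); first exact: memr.
    have := rotP (nat_of_ord (x + t%:R)%R) t tn.
    by rewrite natr_val addrK -addrA -natrD addnn -mul2n linkedC.
  (* A pair at even distance has two opposite midpoints. The one below n is taken, here with radius
     n - t. *)
  set c := nat_of_ord (x + t%:R)%R - n.
  have cE : (c%:R = x + t%:R - n%:R)%R by rewrite [in RHS](low _ cn) addrK.
  exists (rot c); first by apply: memr; have := val_lt (x + t%:R)%R; lia.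
  have : 0 < n - t < n by lia.
  move=> /(rotP c); rewrite (@natrB _ n t); last by lia.
  have -> : (c%:R + (n%:R - t%:R) = x)%R by rewrite cE; ring.
  have -> : (c%:R - (n%:R - t%:R) = x + (t%:R + t%:R) - (n%:R + n%:R))%R by rewrite cE; ring.
  by rewrite nn subr0 -natrD addnn -mul2n.
- move=> m x mh; rewrite mem_filter mem_iota => mm xe.
  have -> : 2 * m + 1 = n by lia.
  have [cn|cn] := ltnP (nat_of_ord x) n.
    by exists (rot (nat_of_ord x)); [exact: memr | have := rung (nat_of_ord x); rewrite natr_val].
  exists (rot (nat_of_ord x - n)); first by apply: memr; have := val_lt x; lia.
  have e : (x + n%:R = (nat_of_ord x - n)%:R)%R by rewrite {1}(low _ cn) -addrA nn addr0.
  by have := rung (nat_of_ord x - n); rewrite -(low _ cn) -e linkedC.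
Qed.

End TriplingInstance.


(** * Quadrupling *)

Section Quadrupling.
Variable Z : finZmodType.
Local Notation Y := (Z * bool)%type.
Variables near far : Z -> seq (Y * Y).
Hypothesis near_size : forall c, size (near c) < #|Z|.
Hypothesis far_size : forall c, size (far c) <= #|Z|.
Hypothesis near_perfect : forall c (x : Y), x.1 != c -> exists y, linked (near c) x y.
Hypothesis far_perfect : forall c, perfect (far c).
Hypothesis near_far : forall x y : Y, x != y ->
  exists c, linked (near c) x y \/ linked (far c) x y.

Local Notation P := ((bool * bool) * Y + bool)%type.

Definition third (x y : Y) : Z := (- (x.1 + y.1))%R.

(* The groups are indexed by (h, e). For x in (h, false) and y in (h, true), one group of the
   half ~~ h is matched by [near (third x y)], the other one by [far (third x y)]; the two
   points missed by [near] go with the two stem points. *)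
Definition fan_block (t : bool * Y * Y * bool) : seq P :=
  let: (h, x, y, q) := t in
  [:: inr (q (+) x.2 (+) h); inl ((h, false), x); inl ((h, true), y);
      inl ((~~ h, x.2 (+) y.2), (third x y, q))].

Definition split_block (b : bool) (t : bool * Y * Y) (e : Y * Y) : seq P :=
  let: (h, x, y) := t in
  [:: inl ((h, false), x); inl ((h, true), y);
      inl ((~~ h, b (+) x.2 (+) y.2), e.1); inl ((~~ h, b (+) x.2 (+) y.2), e.2)].

Definition half_block (h : bool) (e e' : Y * Y) : seq P :=
  [:: inl ((h, false), e.1); inl ((h, false), e.2); inl ((h, true), e'.1); inl ((h, true), e'.2)].

Variable F : seq (seq (Y * Y)).
Hypothesis Ffact : one_factorization #|Z| F.

(** Over all c, the graphs [near c] and [far c] have at most |Z|(2|Z| - 1) edges, as many as the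
    complete graph on [Y]. Since they cover it, nothing is wasted in the count. *)
Definition quadrupling_blocks :=
  [seq fan_block t | t <- enum {: bool * Y * Y * bool}] ++
  flatten [seq [seq split_block false t e | e <- near (third t.1.2 t.2)] | t <- enum {: bool * Y * Y}] ++
  flatten [seq [seq split_block true t e | e <- far (third t.1.2 t.2)] | t <- enum {: bool * Y * Y}] ++
  flatten [seq [seq half_block h e e' | e <- f, e' <- f] | h <- [:: false; true], f <- F].

Local Notation L := quadrupling_blocks.

Lemma fan_blockP t a b c :
  a \in fan_block t -> b \in fan_block t -> c \in fan_block t -> covered L a b c.
Proof.
move=> ha hb hc; apply/coveredP; exists (fan_block t) => //.
by rewrite mem_cat map_f ?mem_enum.
Qed.

Lemma linkedP (T : eqType) (f : seq (T * T)) x y : linked f x y ->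
  exists2 e, e \in f & (e = (x, y)) \/ (e = (y, x)).
Proof. by case/orP=> xy; [exists (x, y) | exists (y, x)] => //; [left | right]. Qed.

Lemma split_blockP b h x y r s : linked (if b then far (third x y) else near (third x y)) r s ->
  let q := [:: inl ((h, false), x); inl ((h, true), y);
      inl ((~~ h, b (+) x.2 (+) y.2), r); inl ((~~ h, b (+) x.2 (+) y.2), s)] : seq P in
  forall p1 p2 p3, p1 \in q -> p2 \in q -> p3 \in q -> covered L p1 p2 p3.
Proof.
move=> /linkedP[e ef he].
have bL : split_block b (h, x, y) e \in L.
  rewrite !mem_cat; apply/orP; right; case: b ef => ef; apply/orP; [right; apply/orP|]; left.
    by apply/flatten_mapP; exists (h, x, y); [rewrite mem_enum | exact: map_f].
  by apply/flatten_mapP; exists (h, x, y); [rewrite mem_enum | exact: map_f].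
move=> q p1 p2 p3; have qe : q =i split_block b (h, x, y) e.
  by move=> p; case: he => -> //; rewrite !inE; do 2 congr (_ || _); rewrite orbC.
by rewrite !qe => ? ? ?; apply/coveredP; exists (split_block b (h, x, y) e).
Qed.

Lemma half_blockP h f x y z t : f \in F -> linked f x y -> linked f z t ->
  let q := [:: inl ((h, false), x); inl ((h, false), y); inl ((h, true), z); inl ((h, true), t)] : seq P in
  forall p1 p2 p3, p1 \in q -> p2 \in q -> p3 \in q -> covered L p1 p2 p3.
Proof.
move=> fF /linkedP[e ef he] /linkedP[e' ef' he'] q p1 p2 p3.
have qe : q =i half_block h e e'.
  move=> p; rewrite /q /half_block; case: he => ->; case: he' => -> /=; rewrite !inE //.
  - by do 2 congr (_ || _); rewrite orbC.
  - by rewrite orbCA.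
  - by rewrite orbCA; do 2 congr (_ || _); rewrite orbC.
rewrite !qe => ? ? ?; apply/coveredP; exists (half_block h e e') => //.
rewrite !mem_cat; do 3 (apply/orP; right).
apply/flattenP; exists [seq half_block h e e' | e <- f, e' <- f].
  apply: (allpairs_f (fun h f => [seq half_block h e e' | e <- f, e' <- f])) => //.
  by rewrite !inE; case: (h).
exact: (allpairs_f (fun e e' => half_block h e e')).
Qed.

Lemma thirdK (c : Z) (x : Y) b : third (- (c + x.1), b)%R x = c.
Proof. by rewrite /third /= opprD opprK addrK. Qed.

Lemma thirdC x y : third x y = third y x.
Proof. by rewrite /third addrC. Qed.

Lemma quad_split h e x y z :
  covered L (inl ((h, false), x)) (inl ((h, true), y)) (inl ((~~ h, e), z)).
Proof.
have [ee|ee] : e = false (+) x.2 (+) y.2 \/ e = true (+) x.2 (+) y.2.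
- by case: e x.2 y.2 => [] [] []; [right|left|left|right|left|right|right|left].
- have [zc|zc] := eqVneq z.1 (third x y).
    apply: (fan_blockP (t := (h, x, y, z.2))); rewrite !inE ?eqxx ?orbT //.
    by rewrite -zc -surjective_pairing ee /= eqxx !orbT.
  have [z' zz'] := near_perfect zc.
  by apply: (@split_blockP false h x y z z') => //; rewrite !inE ?ee ?eqxx ?orbT.
- have [z' zz'] := far_perfect (third x y) z.
  by apply: (@split_blockP true h x y z z') => //; rewrite !inE ?ee ?eqxx ?orbT.
Qed.

(** Within a half the one-factors [F] serve. Otherwise x and y are linked in [near c] or [far c] for
    some c, and the fourth point t is solved from third = c and the parity that names the group of
    the pair. *)
Lemma quad_pair g g' x y z : g != g' -> x != y ->
  covered L (inl (g, x)) (inl (g, y)) (inl (g', z)).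
Proof.
have [_ _ Fp Fl] := Ffact.
case: g g' => [h a] [h' a'] gg xy.
have [hh|hh] := eqVneq h' h.
  have [f fF l] := Fl _ _ xy; have [t zt] := Fp f fF z.
  have aa : a' = ~~ a by move: gg; rewrite hh xpair_eqE eqxx; case: a a' => [] [].
  rewrite hh aa; case: a {gg aa}.
    by apply: (half_blockP (h := h) fF zt l); rewrite !inE !eqxx ?orbT.
  by apply: (half_blockP (h := h) fF l zt); rewrite !inE !eqxx ?orbT.
have {hh} hh : h = ~~ h' by case: h h' hh {gg} => [] [].
have [c cl] := near_far xy.
have [b bl] : exists b, linked (if b then far c else near c) x y.
  by case: cl; [exists false | exists true].
pose t : Y := ((- (c + z.1))%R, b (+) z.2 (+) a).
rewrite {}hh; case: a' {gg}.
  have e : b (+) t.2 (+) z.2 = a by rewrite /t /=; case: b z.2 a {t bl} => [] [] [].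
  apply: (@split_blockP b h' t z x y); rewrite ?thirdK // !inE ?e ?eqxx ?orbT //.
have e : b (+) z.2 (+) t.2 = a by rewrite /t /=; case: b z.2 a {t bl} => [] [] [].
by apply: (@split_blockP b h' z t x y); rewrite 1?thirdC ?thirdK // !inE ?e ?eqxx ?orbT.
Qed.

Lemma quad_fan_other l h a e x z :
  l = z.2 (+) x.2 (+) (a && e) (+) h ->
  covered L (inr l) (inl ((h, a), x)) (inl ((~~ h, e), z)).
Proof.
pose t : Y := ((- (z.1 + x.1))%R, x.2 (+) e).
case: a => /= el.
  have e1 : e = t.2 (+) x.2 by rewrite /t /=; case: x.2 e {t el} => [] [].
  have e2 : z.2 (+) t.2 (+) h = l by rewrite el /t /= !addbA.
  have e3 : third t x = z.1 by rewrite thirdK.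
  apply: (fan_blockP (t := (h, t, x, z.2))); rewrite !inE.
  - by rewrite e2 eqxx.
  - by rewrite eqxx !orbT.
  - by rewrite e3 -e1 -surjective_pairing eqxx !orbT.
have e1 : e = x.2 (+) t.2 by rewrite /t /=; case: x.2 e {t el} => [] [].
have e3 : third x t = z.1 by rewrite thirdC thirdK.
apply: (fan_blockP (t := (h, x, t, z.2))); rewrite !inE.
- by rewrite el addbF eqxx.
- by rewrite eqxx !orbT.
- by rewrite e3 -e1 -surjective_pairing eqxx !orbT.
Qed.

Lemma quad_fan l g g' x y : g != g' ->
  covered L (inr l) (inl (g, x)) (inl (g', y)).
Proof.
case: g g' => [h a] [h' a'] gg.
have [hh|hh] := eqVneq h' h.
  have same u v : covered L (inr l) (inl ((h, false), u)) (inl ((h, true), v)).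
    apply: (fan_blockP (t := (h, u, v, l (+) u.2 (+) h))); rewrite !inE ?eqxx ?orbT //.
    by apply/orP; left; apply/eqP; congr inr; case: l u.2 h {hh gg} => [] [] [].
  by move: gg; rewrite hh; case: a a' => [] [] //; rewrite ?eqxx // covered_swap23 same.
have {}hh : h' = ~~ h by case: h h' hh {gg} => [] [].
rewrite {}hh; have [e|e] := eqVneq l (y.2 (+) x.2 (+) (a && a') (+) h).
  exact: quad_fan_other.
(* The parity condition flips when the two halves trade roles, so one of the two readings always
   applies. *)
rewrite covered_swap23 -{2}[h]negbK; apply: quad_fan_other.
by clear gg; move: e; case: l; case: x.2; case: y.2; case: h; case: a; case: a'.
Qed.

Lemma quad_cover a b c : uniq [:: a; b; c] -> ~~ one_group a b c -> covered L a b c.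
Proof.
have S12 := @covered_swap12 P L; have S23 := @covered_swap23 P L.
have trans i j k x y z : uniq [:: i; j; k] -> covered L (inl (i, x)) (inl (j, y)) (inl (k, z)).
  rewrite uniq3.
  case: i j k => [[] []] [[] []] [[] []] //= _;
    first [ exact: quad_split | by rewrite S12; exact: quad_split
    | by rewrite S23; exact: quad_split | by rewrite S12 S23; exact: quad_split
    | by rewrite S23 S12; exact: quad_split | by rewrite S12 S23 S12; exact: quad_split ].
case: a b c => [[i x]|a] [[j y]|b] [[k z]|c]; rewrite uniq3 /one_group //= => U.
- case: (eqVneq i j) U => [<-|ij] U; case: (eqVneq i k) U => [<-|ik] U; rewrite ?eqxx //= => ng.
  + by apply: quad_pair ik _; case/and3P: U => /eqP xy _ _; apply/eqP => exy; apply: xy; rewrite exy.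
  + rewrite S23; apply: quad_pair ij _.
    by case/and3P: U => _ /eqP xz _; apply/eqP => exz; apply: xz; rewrite exz.
  + have [ejk|jk] := eqVneq j k; last by apply: trans; rewrite uniq3 ij ik.
    subst k; rewrite S12 S23; apply: quad_pair; first by rewrite eq_sym.
    by case/and3P: U => _ _ /eqP yz; apply/eqP => eyz; apply: yz; rewrite eyz.
- by rewrite andbT => ij; rewrite S23 S12 quad_fan.
- by rewrite andbT => ij; rewrite S12 quad_fan.
- by move=> ij; rewrite quad_fan.
Qed.

Lemma quadrupling : sqs_exists (2 * #|Z| + 2) -> sqs_exists (8 * #|Z| + 2).
Proof.
move=> eY; have [F1 F2 _ _] := Ffact.
have cY : #|{: Y}| = 2 * #|Z| by rewrite card_prod card_bool mulnC.
have Z0 : 0 < #|Z| by apply/card_gt0P; exists 0%R.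
have := @fill_groups (bool * bool)%type Y bool L.
have -> : #|{: bool * bool}| = 4 by rewrite card_prod !card_bool.
rewrite cY card_bool; have -> : 4 * (2 * #|Z|) = 8 * #|Z| by rewrite !mulnA.
apply=> //; last 2 first.
- exact: quad_cover.
- have cT : #|{: bool * Y * Y}| = 8 * #|Z| ^ 2.
    by rewrite !card_prod card_bool; ring.
  have : size L <= 16 * #|Z| ^ 2 +
      (8 * #|Z| ^ 2 * #|Z|.-1 + (8 * #|Z| ^ 2 * #|Z| + 2 * #|Z|.*2.-1 * #|Z| ^ 2)).
    rewrite !size_cat; do 3?[apply: leq_add].
    - by rewrite size_map -cardE card_prod card_bool cT mulnAC.
    - rewrite -cT cardE; apply: size_flatten_leq => t _.
      by rewrite size_map -ltnS prednK.
    - by rewrite -cT cardE; apply: size_flatten_leq => t _; rewrite size_map.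
    rewrite -[X in flatten X]map_id; apply: leq_trans (size_flatten_leq (k := #|Z| ^ 2) _) _.
      by move=> _ /allpairsP[[h f] [_ /= /F2 fn ->]]; rewrite size_allpairs leq_mul // muln1.
    by rewrite size_allpairs F1.
  have := ffact3E (8 * #|Z| + 2); have := ffact3E (2 * #|Z| + 2).
  have -> : 2 ^_ 3 = 0 by [].
  move: ((8 * #|Z| + 2) ^_ 3) ((2 * #|Z| + 2) ^_ 3) (size L).
  case: #|Z| Z0 => // k _ f1 f2 l; rewrite !expnS expn0 /=.
  rewrite -mul2n; lia.
rewrite !all_cat; apply/and4P; split; apply/allP => q.
- by case/mapP=> [[[[h x] y] r] _ ->].
- by case/flatten_mapP=> [[[h x] y] _] /mapP[e _ ->].
- by case/flatten_mapP=> [[[h x] y] _] /mapP[e _ ->].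
- by case/flattenP=> ? /allpairsP[? [_ _ ->]] /allpairsP[? [_ _ ->]].
Qed.

End Quadrupling.


(** * Hanani's theorem *)

Section Fibres.
Variable Z : finZmodType.
Local Notation Y := (Z * bool)%type.

Definition on_fibres (f : seq (Z * Z)) : seq (Y * Y) :=
  [seq ((e.1, false), (e.2, false)) | e <- f] ++ [seq ((e.1, true), (e.2, true)) | e <- f].

Lemma on_fibres_linked f x y b : linked f x y -> linked (on_fibres f) (x, b) (y, b).
Proof.
move=> l; rewrite linked_cat; apply/orP; case: b.
  by right; apply: (linked_map (fun z => (z, true))).
by left; apply: (linked_map (fun z => (z, false))).
Qed.

Definition slope (d : Z) : seq (Y * Y) := [seq ((x, false), (x + d, true))%R | x <- enum Z].

Lemma size_slope d : size (slope d) = #|Z|.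
Proof. by rewrite size_map -cardE. Qed.

Lemma slope_linked d x y : (y - x = d)%R -> linked (slope d) (x, false) (y, true).
Proof.
move=> <-; apply/orP; left; apply/mapP; exists x; first by rewrite mem_enum.
by rewrite addrC subrK.
Qed.

Lemma slope_perfect d : perfect (slope d).
Proof.
move=> [x []]; last by exists (x + d, true)%R; apply: slope_linked; rewrite addrC addKr.
by exists (x - d, false)%R; rewrite linkedC; apply: slope_linked; rewrite opprB addrC subrK.
Qed.

Lemma slope_exists (x y : Y) : x.2 != y.2 -> exists d, linked (slope d) x y.
Proof.
case: x y => [x []] [y []] //= _.
  by exists (x - y)%R; rewrite linkedC; apply: slope_linked.
by exists (y - x)%R; apply: slope_linked.
Qed.

Lemma fibre_factorization : exists F : seq (seq (Y * Y)), one_factorization #|Z| F.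
Proof.
apply: one_factorization_exists; first by rewrite card_prod card_bool muln2.
by apply/card_gt0P; exists 0%R.
Qed.

End Fibres.

(** In odd order a reflection misses only its centre c: spokes on both fibres are the near graphs,
    for pairs inside a fibre, and slopes the far graphs, for pairs across. *)
Lemma quadrupling_odd r : sqs_exists (2 * r.*2.+1 + 2) -> sqs_exists (8 * r.*2.+1 + 2).
Proof.
have [F FF] := fibre_factorization 'I_(r.*2).+1.
have := @quadrupling 'I_(r.*2).+1 (fun c => on_fibres (spokes c)) (@slope _) _ _ _ _ _ F FF.
rewrite card_ord; apply.
- by move=> c; rewrite size_cat !size_map size_iota; lia.
- by move=> d; rewrite size_slope card_ord.
- move=> c [x b] xc; exists (c + c - x, b)%R.
  by apply: on_fibres_linked; apply: spokes_linked.
- exact: slope_perfect.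
move=> x y xy; have [e|ne] := eqVneq x.2 y.2; last first.
  by have [d l] := slope_exists ne; exists d; right.
case: x y xy e => [x b] [y c] xy /= e; subst c.
have [|c l] := @spokes_exists r x y; first by apply: contra xy => /eqP->.
by exists c; left; apply: on_fibres_linked.
Qed.

Section QuadruplingEven.
Variable r : nat.
Hypothesis r0 : 0 < r.
Local Notation Z := 'Z_(2 * r).
Let p := r./2.
Let q := r.-1./2.
Let a := 2 * p + 1 + q.

(* Pairs of residues with differences 1, ..., r-1, partitioning {1, ..., 2r-1} minus a:
   the odd differences sit around p + 1/2, the even ones around a. *)
Definition near_base : seq (nat * nat) :=
  [seq (1 + t, 2 * p - t) | t <- iota 0 p] ++ [seq (a - t, a + t) | t <- iota 1 q].

Lemma near_base_cover d : 0 < d < 2 * r -> d != a -> exists e, linked near_base d e.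
Proof.
move=> dr da; have [dp|dp] := ltnP d p.+1.
  exists (2 * p - (d - 1)); rewrite linked_cat; apply/orP; left; apply/orP; left.
  by apply/mapP; exists (d - 1); [rewrite mem_iota; lia | congr pair; lia].
have [d2p|d2p] := leqP d (2 * p).
  exists (1 + (2 * p - d)); rewrite linked_cat; apply/orP; left; apply/orP; right.
  by apply/mapP; exists (2 * p - d); [rewrite mem_iota; lia | congr pair; lia].
have [dla|dla] := ltnP d a.
  exists (a + (a - d)); rewrite linked_cat; apply/orP; right; apply/orP; left.
  by apply/mapP; exists (a - d); [rewrite mem_iota; lia | congr pair; lia].
exists (a - (d - a)); rewrite linked_cat; apply/orP; right; apply/orP; right.
by apply/mapP; exists (d - a); [rewrite mem_iota; lia | congr pair; lia].
Qed.

Lemma near_base_diff d : 0 < d < r -> exists e, (e, e + d) \in near_base.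
Proof.
move=> dr; have [od|ed] := boolP (odd d).
  exists (p - d./2); rewrite mem_cat; apply/orP; left; apply/mapP.
  by exists (p - d./2 - 1); [rewrite mem_iota; lia | congr pair; lia].
exists (a - d./2); rewrite mem_cat; apply/orP; right; apply/mapP.
by exists d./2; [rewrite mem_iota; lia | congr pair; lia].
Qed.

(** In even order no matching of a fibre misses c alone. [near_base] also misses a, and the two
    points over c + a are joined to each other. This consumes the pairs of slope 0, so the far graph
    at 0 is free for the difference r, absent from the near graphs. *)
Definition near_even (c : Z) : seq ((Z * bool) * (Z * bool)) :=
  ((c + a%:R, false), (c + a%:R, true))%R ::
  on_fibres [seq (c + e.1%:R, c + e.2%:R)%R | e <- near_base].

Definition far_even (c : Z) : seq ((Z * bool) * (Z * bool)) :=
  if c == 0%R then on_fibres [seq (x%:R, (x + r)%:R)%R | x <- iota 0 r] else slope c.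

Lemma near_even_linked c d e b : linked near_base d e ->
  linked (near_even c) (c + d%:R, b)%R (c + e%:R, b)%R.
Proof.
move=> l; rewrite /near_even -cat1s linked_cat on_fibres_linked ?orbT //.
exact: (linked_map (fun d => c + d%:R)%R).
Qed.

Lemma quadrupling_even : sqs_exists (2 * (2 * r) + 2) -> sqs_exists (8 * (2 * r) + 2).
Proof.
have cZ : #|{: Z}| = 2 * r by rewrite card_ord Zp_cast // twon_gt1.
have [F FF] := fibre_factorization Z.
have := @quadrupling Z near_even far_even _ _ _ _ _ F FF; rewrite cZ; apply.
- move=> c; rewrite /= size_cat !size_map size_cat !size_map !size_iota; lia.
- move=> c; rewrite /far_even; case: ifP => _; last by rewrite size_slope cZ.
  by rewrite size_cat !size_map size_iota; lia.
- move=> c [x b] /= xc; pose d := nat_of_ord (x - c)%R.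
  have ex : (x = c + d%:R)%R by rewrite natr_val // addrC subrK.
  have [da|da] := eqVneq d a.
    by exists (x, ~~ b); rewrite ex da; case: b; [rewrite linkedC|]; rewrite /linked mem_head.
  have [|e l] := @near_base_cover d _ da.
    by rewrite (val_lt r0) andbT lt0n -[0]/(nat_of_ord (0 : Z)%R) (inj_eq (@ord_inj _)) subr_eq0.
  by exists (c + e%:R, b)%R; rewrite ex; apply: near_even_linked.
- move=> c; rewrite /far_even; case: ifP => _; last exact: slope_perfect.
  move=> [x b]; have [xr|xr] := ltnP (nat_of_ord x) r.
    exists ((nat_of_ord x + r)%:R%R, b); apply: on_fibres_linked; apply/orP; left.
    by apply/mapP; exists (nat_of_ord x); rewrite ?mem_iota // natr_val.
  exists ((nat_of_ord x - r)%:R%R, b); rewrite linkedC; apply: on_fibres_linked; apply/orP; left.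
  apply/mapP; exists (nat_of_ord x - r); first by rewrite mem_iota; have := val_lt r0 x; lia.
  by rewrite subnK // natr_val.
have slopes c x y : c != 0%R -> (y - x = c)%R ->
    linked (far_even c) (x, false) (y, true).
  by move=> c0 yx; rewrite /far_even (negPf c0); exact: slope_linked.
have close b x y : 0 < nat_of_ord (y - x)%R < r -> exists c, linked (near_even c) (x, b) (y, b).
  move=> /near_base_diff[e eb]; exists (x - e%:R)%R.
  have l : linked near_base e (e + nat_of_ord (y - x)%R) by rewrite /linked eb.
  by have := near_even_linked (x - e%:R)%R b l; rewrite natrD natr_val // addrA subrK addrC subrK.
move=> [x b] [y b'] xy; have [eb|ne] := eqVneq b b'; last first.
  have [exy|xny] := eqVneq x y.
    exists (x - a%:R)%R; left; rewrite -exy /linked /near_even !inE subrK.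
    by case: b b' ne {xy} => [] [] // _; rewrite !eqxx ?orbT.
  case: b b' ne {xy} => [] [] // _.
    by exists (x - y)%R; right; rewrite linkedC slopes // subr_eq0.
  by exists (y - x)%R; right; rewrite slopes // subr_eq0 eq_sym.
subst b'; have {}xy : x != y by apply: contra xy => /eqP->.
pose d := nat_of_ord (y - x)%R; have d2 : d < 2 * r := val_lt r0 _.
have d0 : 0 < d by rewrite lt0n -[0]/(nat_of_ord (0 : Z)%R) (inj_eq (@ord_inj _)) subr_eq0 eq_sym.
have [dr|rd] := ltnP d r.
  by have [|c l] := close b x y; [rewrite d0 | exists c; left].
have [edr|dnr] := eqVneq d r.
  exists 0%R; right; rewrite /far_even eqxx; apply: on_fibres_linked.
  have ed : (y - x = d%:R)%R by rewrite natr_val.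
  rewrite edr in ed; have ey : (y = x + r%:R)%R by rewrite -ed addrC subrK.
  have [xr|xr] := ltnP (nat_of_ord x) r.
    apply/orP; left; apply/mapP; exists (nat_of_ord x); first by rewrite mem_iota.
    by rewrite natrD natr_val // -ey.
  apply/orP; right; apply/mapP; exists (nat_of_ord x - r).
    by rewrite mem_iota; have := val_lt r0 x; lia.
  have rr : (r%:R + r%:R = 0 :> Z)%R by rewrite -natrD addnn -mul2n natr_2n.
  have ex : (x = (nat_of_ord x - r)%:R + r%:R)%R by rewrite -natrD subnK // natr_val.
  by rewrite subnK // natr_val // ey {1}ex -addrA rr addr0.
have [|c l] := close b y x; last by exists c; left; rewrite linkedC.
have -> : (x - y = (2 * r - d)%:R)%R by rewrite (natr_2n_sub r0 (ltnW d2)) natr_val // opprB.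
rewrite val_natr // modn_small; lia.
Qed.

End QuadruplingEven.

Lemma sqs_exists_quad k : 0 < k -> sqs_exists (2 * k + 2) -> sqs_exists (8 * k + 2).
Proof.
move=> k0; have [ok|ek] := boolP (odd k).
  by rewrite (_ : k = k./2.*2.+1); [exact: quadrupling_odd | lia].
by rewrite (_ : k = 2 * k./2); [apply: quadrupling_even; lia | lia].
Qed.

(** Hanani's recursions from u to 2u, 3u - 2, 3u - 4, 3u - 8, 12u - 10 and 4u - 6. They serve, in
    this order, the multiples of 4, then 10 and 22, 26, 34 modulo 36, then 14 and 38 modulo 72, and
    the rest 2 and 50 modulo 72. Order 14 is set apart since the 12-fold step presupposes it. *)
Theorem sqs_exists_2_4_mod_6 v : (v %% 6 == 2) || (v %% 6 == 4) -> sqs_exists v.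
Proof.
have [m] := ubnP v; elim: m v => // m IH v /ltnSE vm v6.
have rec u : u < v -> (u %% 6 == 2) || (u %% 6 == 4) -> sqs_exists u.
  by move=> uv; apply: IH; exact: leq_trans uv vm.
have [v2|v2] := leqP v 2; first by rewrite (_ : v = 2); [exact: sqs_exists_2 | lia].
have [->|v14] := eqVneq v 14; first exact: sqs_exists_14.
have [d4|nd4] := boolP (4 %| v).
  have -> : v = 2 * (v %/ 2) by lia.
  by apply: sqs_exists_mul2; [lia | apply: rec; lia].
have [r|r] := boolP ((v %% 36 == 10) || (v %% 36 == 22)).
  have -> : v = 3 * ((v + 2) %/ 3) - 2 by lia.
  by apply: sqs_exists_mul3; [lia | apply: rec; lia].
have [r26|r26] := eqVneq (v %% 36) 26.
  (* With h = 2 * (v %/ 36) + 1 odd, n = 3h + 1 is even here and n = 3h + 2 is odd in the next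
     case. *)
  pose n := 3 * (2 * (v %/ 36) + 1) + 1.
  have -> : v = 3 * (2 * n) + 2 by rewrite /n; lia.
  apply: (@tripling_even (2 * (v %/ 36) + 1)) => //; rewrite ?/n; try lia.
  by apply: rec; lia.
have [r34|r34] := eqVneq (v %% 36) 34.
  pose n := 3 * (2 * (v %/ 36) + 1) + 2.
  have -> : v = 3 * (2 * n) + 4 by rewrite /n; lia.
  apply: (@tripling_odd (2 * (v %/ 36) + 1)) => //; rewrite ?/n; try lia.
  by apply: rec; lia.
have [r72|r72] := boolP ((v %% 72 == 14) || (v %% 72 == 38)).
  have -> : v = 12 * ((v + 10) %/ 12) - 10 by lia.
  by apply: sqs_exists_mul12; [lia | apply: rec; lia].
have -> : v = 8 * ((v - 2) %/ 8) + 2 by lia.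
by apply: sqs_exists_quad; [lia | apply: rec; lia].
Qed.


(** * Lindner's construction *)

Section Halves.
Variable X : finType.
Local Notation P := (X * bool)%type.

Definition slice (b : bool) (s : {set P}) : {set X} := [set x | (x, b) \in s].

Definition place (r s : seq X) : seq P := [seq (x, false) | x <- r] ++ [seq (x, true) | x <- s].

Lemma mem_place r s x b : ((x, b) \in place r s) = (x \in if b then s else r).
Proof.
have map_pair b' t : ((x, b) \in [seq (y, b') | y <- t]) = (b == b') && (x \in t).
  by apply/mapP/andP=> [[y yt [-> ->]]|[/eqP-> xt]]; [rewrite eqxx | exists x].
by rewrite mem_cat !map_pair; case: (b) => //=; rewrite orbF.
Qed.

Lemma slice_place b r s : slice b [set p in place r s] = [set x in if b then s else r].
Proof. by apply/setP=> x; rewrite !inE mem_place. Qed.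

Lemma covered_halves (L : seq (seq P)) :
  (forall x y z b, uniq [:: x; y; z] -> covered L (x, b) (y, b) (z, b)) ->
  (forall x y z b, x != y -> covered L (x, b) (y, b) (z, ~~ b)) ->
  forall a b c, uniq [:: a; b; c] -> covered L a b c.
Proof.
move=> H3 H2 [x i] [y j] [z k]; rewrite uniq3 => /and3P[].
have [<-|ij] := eqVneq i j; have [<-|ik] := eqVneq i k.
- rewrite !xpair_eqE !eqxx !andbT => xy xz yz; apply: H3; by rewrite uniq3 xy xz.
- rewrite xpair_eqE eqxx andbT => xy _ _; have -> : k = ~~ i by case: i k ik => [] [].
  exact: H2.
- rewrite [in X in _ -> X -> _]xpair_eqE eqxx andbT => _ xz _.
  have -> : j = ~~ i by case: i j ij => [] [].
  by rewrite covered_swap23 H2.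
have jk : k = j by case: i j k ij ik => [] [] [].
have -> : i = ~~ j by case: i j {jk} ij ik => [] [].
rewrite jk [in X in _ -> _ -> X -> _]xpair_eqE eqxx andbT => _ _ yz.
by rewrite covered_swap12 covered_swap23 H2.
Qed.

End Halves.

Section Lindner.
Variable X : finType.
Local Notation P := (X * bool)%type.
Variables (B : {set {set X}}) (f g : X -> X).
Hypothesis sB : sqs B.
Hypotheses (fK : cancel f g) (gK : cancel g f).

(* The second family uses the blocks of B itself, not their images under f, in the second
   half: so systems with distinct f are disjoint there. *)
Definition lindner_blocks : seq (seq P) :=
  flatten [seq [seq place (rem w (enum b)) [:: f w] | w <- enum b] | b : {set X} <- enum B] ++
  flatten [seq [seq place [:: g w] (rem w (enum b)) | w <- enum b] | b : {set X} <- enum B] ++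
  [seq place (enum e) [seq f x | x <- enum e] | e : {set X} <- enum [set e : {set X} | #|e| == 2]].

Lemma sqs_block x y z : uniq [:: x; y; z] -> exists2 b, b \in B & [/\ x \in b, y \in b & z \in b].
Proof.
move=> U; have [_ cov _] := quad_list_enum sB.
have /coveredP[q /mapP[b bB ->] [xb yb zb]] := cov _ _ _ U.
by exists b; move: bB xb yb zb; rewrite !mem_enum.
Qed.

Lemma sqs_fourth x y z b : b \in B -> uniq [:: x; y; z] -> x \in b -> y \in b -> z \in b ->
  exists2 w, w \in b & w \notin [:: x; y; z].
Proof.
move=> bB U xb yb zb; apply/exists_inP; apply: contraT; rewrite negb_exists_in => /forall_inP H.
suff : #|b| <= 3 by rewrite sB.1.
have <- : #|[:: x; y; z]| = 3 by rewrite (card_uniqP U).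
by apply/subset_leq_card/subsetP => w /H; rewrite negbK.
Qed.

(** For x, y in the first half and z in the second, take w = g z. If w is x or y, the pair family
    holds the triple; otherwise the block of [B] through x, y, w does, with w sent across to f w =
    z. The mirrored case uses f z. *)
Lemma lindner_cover a b c : uniq [:: a; b; c] -> covered lindner_blocks a b c.
Proof.
have mem1 b0 w : b0 \in B -> w \in b0 -> place (rem w (enum b0)) [:: f w] \in lindner_blocks.
  move=> bB wb; rewrite mem_cat; apply/orP; left; apply/flatten_mapP; exists b0; rewrite ?mem_enum //.
  by apply: map_f; rewrite mem_enum.
have mem2 b0 w : b0 \in B -> w \in b0 -> place [:: g w] (rem w (enum b0)) \in lindner_blocks.
  move=> bB wb; rewrite !mem_cat; apply/orP; right; apply/orP; left; apply/flatten_mapP; exists b0; rewrite ?mem_enum //.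
  by apply: map_f; rewrite mem_enum.
have mem3 x y : x != y -> exists2 q, q \in lindner_blocks &
    [/\ (x, false) \in q, (y, false) \in q, (f x, true) \in q & (f y, true) \in q].
  move=> xy; exists (place (enum [set x; y]) [seq f x | x <- enum [set x; y]]).
    rewrite !mem_cat; apply/orP; right; apply/orP; right; apply/mapP; exists [set x; y] => //.
    by rewrite mem_enum inE cards2 xy.
  by rewrite !mem_place !(mem_map (can_inj fK)) !mem_enum !inE !eqxx orbT.
have mrem b0 w x : (x \in rem w (enum (b0 : {set X}))) = (x != w) && (x \in b0).
  by rewrite mem_rem_uniq ?enum_uniq // inE mem_enum.
move: a b c; apply: covered_halves => [x y z [] U|x y z [] xy].
- have [b bB [xb yb zb]] := sqs_block U; have [w wb wn] := sqs_fourth bB U xb yb zb.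
  apply/coveredP; exists (place [:: g w] (rem w (enum b))); first exact: mem2.
  rewrite !mem_place !mrem xb yb zb !andbT; move: wn; rewrite !inE !negb_or.
  by rewrite ![w == _]eq_sym => /and3P[].
- have [b bB [xb yb zb]] := sqs_block U; have [w wb wn] := sqs_fourth bB U xb yb zb.
  apply/coveredP; exists (place (rem w (enum b)) [:: f w]); first exact: mem1.
  rewrite !mem_place !mrem xb yb zb !andbT; move: wn; rewrite !inE !negb_or.
  by rewrite ![w == _]eq_sym => /and3P[].
- have [fx|fx] := eqVneq (f z) x.
    have [|q qL [q1 _ q3 q4]] := mem3 z (g y); first by apply: contra xy => /eqP e; rewrite -fx e gK.
    by apply/coveredP; exists q => //; split=> //; [rewrite -fx | rewrite -[y]gK].
  have [fy|fy] := eqVneq (f z) y.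
    have [|q qL [q1 _ q3 q4]] := mem3 z (g x); first by apply: contra xy => /eqP e; rewrite -fy e gK.
    by apply/coveredP; exists q => //; split=> //; [rewrite -[x]gK | rewrite -fy].
  have [b bB [xb yb zb]] : exists2 b, b \in B & [/\ x \in b, y \in b & f z \in b].
    by apply: sqs_block; rewrite uniq3 xy [x == _]eq_sym fx [y == _]eq_sym.
  apply/coveredP; exists (place [:: g (f z)] (rem (f z) (enum b))); first exact: mem2.
  by rewrite !mem_place !mrem xb yb /= fK inE eqxx [x == _]eq_sym fx [y == _]eq_sym fy.
- have [gx|gx] := eqVneq (g z) x.
    have [q qL [q1 q2 q3 _]] := mem3 x y xy.
    by apply/coveredP; exists q => //; split=> //; rewrite -[z]gK gx.
  have [gy|gy] := eqVneq (g z) y.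
    have [q qL [q1 q2 _ q4]] := mem3 x y xy.
    by apply/coveredP; exists q => //; split=> //; rewrite -[z]gK gy.
  have [b bB [xb yb zb]] : exists2 b, b \in B & [/\ x \in b, y \in b & g z \in b].
    by apply: sqs_block; rewrite uniq3 xy [x == _]eq_sym gx [y == _]eq_sym.
  apply/coveredP; exists (place (rem (g z) (enum b)) [:: f (g z)]); first exact: mem1.
  by rewrite !mem_place !mrem xb yb /= gK inE eqxx [x == _]eq_sym gx [y == _]eq_sym gy.
Qed.

Lemma lindner_quad_list : quad_list lindner_blocks.
Proof.
have szp r s : size (place r s : seq P) = size r + size s by rewrite size_cat !size_map.
split; last 1 first.
- have [_ _] := quad_list_enum sB; rewrite size_map => nB.
  have s4 (h : {set X} -> X -> seq P) :
      size (flatten [seq [seq h b w | w <- enum b] | b : {set X} <- enum B]) <= size (enum B) * 4.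
    apply: size_flatten_leq => b; rewrite mem_enum => bB.
    by rewrite size_map -cardE sB.1.
  have := s4 (fun b w => place (rem w (enum b)) [:: f w]).
  have := s4 (fun b w => place [:: g w] (rem w (enum b))).
  have := ffact3E #|X|; have := ffact3E (#|X| * 2); have := bin_ffact #|X| 2.
  have c2 : size (enum [set e : {set X} | #|e| == 2]) = 'C(#|X|, 2).
    by rewrite -cardE -cardsT -cards_draws; apply: eq_card => e; rewrite !inE subsetT.
  have x2 : #|X| ^_ 2 + #|X| = #|X| ^ 2.
    by case: #|X| => // n; rewrite ffactSS ffactn1 !expnS expn0; lia.
  rewrite !size_cat [size (map _ _)]size_map c2 card_prod card_bool.
  move: nB x2; rewrite -[2`!]/2.
  move: (size (flatten _)) (size (flatten _)) (size (enum B)) => l1 l2 m.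
  move: (#|X| ^_ 3) ((#|X| * 2) ^_ 3) ('C(_, _)) (#|X| ^_ 2) => f1 f2 c f3.
  move: #|X| => n; rewrite !expnS !expn0; lia.
- rewrite !all_cat; apply/and3P; split; apply/allP => q.
  + case/flatten_mapP=> b; rewrite mem_enum => bB /mapP[w wb ->].
    by rewrite szp size_rem //= -cardE sB.1.
  + case/flatten_mapP=> b; rewrite mem_enum => bB /mapP[w wb ->].
    by rewrite szp size_rem //= -cardE sB.1.
  + case/mapP=> e; rewrite mem_enum inE => /eqP e2 ->.
    by rewrite szp size_map -cardE e2.
exact: lindner_cover.
Qed.

End Lindner.


(** * Doubling and assembly *)

Section Representatives.
Variables (X : finType) (f : X -> X).
Hypotheses (fI : involutive f) (fN : forall x, f x != x).

(** One endpoint of each edge {x, f x}; listing both would spoil the count of doubling blocks. *)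
Definition reps := [seq x <- enum X | enum_rank x < enum_rank (f x)].

Lemma size_reps : 2 * size reps <= #|X|.
Proof.
pose r (x : X) := nat_of_ord (enum_rank x).
have sR : size reps = #|[pred x | r x < r (f x)]|.
  rewrite -(card_uniqP _); last by rewrite filter_uniq ?enum_uniq.
  by apply: eq_card => x; rewrite mem_filter mem_enum andbT.
have eqR : #|[pred x | r x < r (f x)]| = #|[pred x | r (f x) < r x]|.
  rewrite -(card_image (inv_inj fI)); apply: eq_card => y; rewrite !inE.
  apply/imageP/idP => [[x]|ry]; first by rewrite inE => rx ->; rewrite fI.
  by exists (f y); rewrite ?inE ?fI.
rewrite mul2n -addnn {1}sR sR {2}eqR -cardUI addnC (eq_card0 (A := predI _ _)).
  by rewrite add0n max_card.
by move=> x; rewrite !inE; apply/negP => /andP[]; lia.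
Qed.

Lemma repsP x : exists2 y, y \in reps & (x = y \/ x = f y).
Proof.
have [rx|rx|rx] := ltngtP (enum_rank x) (enum_rank (f x)).
- by exists x; [rewrite mem_filter rx mem_enum | left].
- by exists (f x); [rewrite mem_filter fI rx mem_enum | right; rewrite fI].
by move/ord_inj/enum_rank_inj/eqP: rx; rewrite eq_sym (negPf (fN x)).
Qed.

End Representatives.

Section Doubling.
Variables (X C : finType) (B : {set {set X}}) (p q : C -> X -> X).
Local Notation P := (X * bool)%type.
Hypothesis sB : sqs B.
Hypotheses (pI : forall c, involutive (p c)) (pN : forall c x, p c x != x).
Hypotheses (qI : forall c, involutive (q c)) (qN : forall c x, q c x != x).
Hypothesis p_all : forall x y, x != y -> exists c, p c x = y.
Hypothesis q_all : forall x y, x != y -> exists c, q c x = y.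
Hypothesis cC : #|C|.+1 = #|X|.

Definition doubling_blocks : seq (seq P) :=
  [seq place (enum b) [::] | b : {set X} <- enum B] ++
  [seq place [::] (enum b) | b : {set X} <- enum B] ++
  flatten [seq [seq place [:: x; p c x] [:: z; q c z] | x <- reps (p c), z <- reps (q c)] | c <- enum C].

Lemma doubling_quad_list : quad_list doubling_blocks.
Proof.
split.
- rewrite !all_cat; apply/and3P; split; apply/allP => t.
  + case/mapP=> b; rewrite mem_enum => bB ->.
    by rewrite size_cat !size_map -cardE sB.1.
  + case/mapP=> b; rewrite mem_enum => bB ->.
    by rewrite size_cat !size_map -cardE sB.1.
  + by case/flatten_mapP=> c _ /allpairsP[[x z] [_ _ ->]].
- have cross c x y : exists2 t, t \in doubling_blocks &
      [/\ (x, false) \in t, (p c x, false) \in t, (y, true) \in t & (q c y, true) \in t].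
    have [x' xr ex] := repsP (pI c) (pN c) x; have [y' yr ey] := repsP (qI c) (qN c) y.
    exists (place [:: x'; p c x'] [:: y'; q c y']).
      rewrite !mem_cat; apply/orP; right; apply/orP; right; apply/flatten_mapP.
      exists c; first by rewrite mem_enum.
      exact: (allpairs_f (fun x z => place [:: x; p c x] [:: z; q c z])).
    rewrite !mem_place !inE.
    by case: ex => ->; case: ey => ->; rewrite ?pI ?qI !eqxx ?orbT.
  apply: covered_halves => [x y z b U|x y z b xy].
    have [d dB [xd yd zd]] := sqs_block sB U; apply/coveredP.
    exists (if b then place [::] (enum d) else place (enum d) [::]).
      by case: b; rewrite !mem_cat (map_f (fun d => place _ _)) ?mem_enum ?orbT.
    by case: b; rewrite !mem_place !mem_enum.
  apply/coveredP; case: b.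
    have [c <-] := q_all xy; have [t tL [h1 _ h3 h4]] := cross c z x; by exists t.
  by have [c <-] := p_all xy; have [t tL [h1 h2 h3 _]] := cross c x z; exists t.
have [_ _] := quad_list_enum sB; rewrite size_map => nB.
have sz : size (flatten [seq [seq place [:: x; p c x] [:: z; q c z] | x <- reps (p c), z <- reps (q c)]
     | c <- enum C]) <= #|C| * (#|X|./2 * #|X|./2).
  rewrite cardE; apply: size_flatten_leq => c _; rewrite size_allpairs.
  have hr k : 2 * k <= #|X| -> k <= #|X|./2 by move: #|X| => n; lia.
  by apply: leq_mul; apply: hr; exact: size_reps.
rewrite !size_cat 2!size_map card_prod card_bool; move: sz nB.
have := ffact3E #|X|; have := ffact3E (#|X| * 2); rewrite -cC.
have h2 : 2 * #|C|.+1./2 <= #|C|.+1 by lia.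
have := leq_mul h2 h2; have := leq_mul (leqnn #|C|) (leq_mul h2 h2).
move: (size (flatten _)) (size (enum B)) (#|C|.+1 ^_ 3) ((#|C|.+1 * 2) ^_ 3) (#|C|.+1./2) => l m f1 f2 t.
move: #|C| => c; rewrite !expnS !expn0; nia.
Qed.

Lemma doublingP s : s \in blocks doubling_blocks ->
  [\/ slice false s \in B /\ slice true s = set0,
      slice false s = set0 /\ slice true s \in B
    | exists c x z, slice false s = [set x; p c x] /\ slice true s = [set z; q c z]].
Proof.
rewrite inE => /mapP[t + ->]; rewrite !mem_cat => /or3P[].
- case/mapP=> b; rewrite mem_enum => bB ->; constructor 1; rewrite !slice_place set_enum.
  by split=> //; apply/setP=> x; rewrite !inE.
- case/mapP=> b; rewrite mem_enum => bB ->; constructor 2; rewrite !slice_place set_enum.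
  by split=> //; apply/setP=> x; rewrite !inE.
case/flatten_mapP=> c _ /allpairsP[[x z] [_ _ ->]]; constructor 3; exists c, x, z.
by rewrite !slice_place; split; apply/setP=> y; rewrite !inE.
Qed.

End Doubling.

Lemma lindnerP (X : finType) (B : {set {set X}}) (f g : X -> X) s :
  s \in blocks (lindner_blocks B f g) ->
  [\/ exists b w, [/\ b \in B, w \in b, slice false s = b :\ w & slice true s = [set f w]],
      exists b w, [/\ b \in B, w \in b, slice true s = b :\ w & slice false s = [set g w]]
    | exists x y, [/\ x != y, slice false s = [set x; y] & slice true s = [set f x; f y]]].
Proof.
have rm (b : {set X}) w : [set x in rem w (enum b)] = b :\ w.
  by apply/setP=> x; rewrite !inE mem_rem_uniq ?enum_uniq // inE mem_enum.
rewrite inE => /mapP[t + ->]; rewrite !mem_cat => /or3P[].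
- case/flatten_mapP=> b; rewrite mem_enum => bB /mapP[w]; rewrite mem_enum => wb ->.
  constructor 1; exists b, w; rewrite !slice_place rm; split=> //.
  by apply/setP=> y; rewrite !inE.
- case/flatten_mapP=> b; rewrite mem_enum => bB /mapP[w]; rewrite mem_enum => wb ->.
  constructor 2; exists b, w; rewrite !slice_place rm; split=> //.
  by apply/setP=> y; rewrite !inE.
case/mapP=> e; rewrite mem_enum inE => /cards2P[x [y [xy ee]]] ->.
constructor 3; exists x, y; rewrite !slice_place set_enum; split=> //.
apply/setP=> u; rewrite !inE; apply/mapP/orP => [[v]|].
  by rewrite mem_enum ee !inE => /orP[] /eqP-> ->; [left|right].
by case=> /eqP->; [exists x | exists y]; rewrite // mem_enum ee !inE eqxx ?orbT.
Qed.

Section Assembly.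
Variables (X A : finType) (C : finZmodType) (lam : X -> X -> C) (p : C -> X -> X).
Hypothesis lamC : forall x y, lam x y = lam y x.
Hypothesis p_lam : forall x y, x != y -> p (lam x y) x = y.
Hypothesis cC : #|C|.+1 = #|X|.

(* The injection [lam x] of the other points into [C] is onto by counting. *)
Lemma lam_onto c x : exists2 y, x != y & lam x y = c.
Proof.
have inj : {in [set~ x] &, injective (lam x)}.
  move=> y z; rewrite !inE [y == x]eq_sym [z == x]eq_sym => xy xz e.
  by rewrite -(p_lam xy) e p_lam.
have : c \in lam x @: [set~ x].
  have /eqP-> : lam x @: [set~ x] == setT; last by rewrite inE.
  by rewrite eqEcard subsetT cardsT (card_in_imset inj) cardsC1 -cC /=.
by case/imsetP=> y; rewrite !inE eq_sym => xy ->; exists y.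
Qed.

Lemma lam_p c x : lam x (p c x) = c.
Proof. by have [y xy <-] := lam_onto c x; rewrite p_lam. Qed.

Lemma pN c x : p c x != x.
Proof. by have [y xy <-] := lam_onto c x; rewrite p_lam // eq_sym. Qed.

Lemma pI c : involutive (p c).
Proof. by move=> x; rewrite -{1}(lam_p c x) lamC p_lam // pN. Qed.

Variables al be : A -> X -> X.
Hypotheses (alK : forall a, cancel (al a) (be a)) (beK : forall a, cancel (be a) (al a)).
Hypothesis al_inj : forall a a' x, al a x = al a' x -> a = a'.
Hypothesis al_swap : forall a a' x y, x != y -> al a x = al a' y -> al a y = al a' x -> a = a'.
Variables (m : nat) (kap : 'I_m -> C).
Hypothesis kap_inj : injective kap.
Hypothesis kap_al : forall a x y j, x != y -> lam (al a x) (al a y) != (lam x y + kap j)%R.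
Variables (B0 : {set {set X}}) (G : 'I_m -> {set {set X}}).
Hypotheses (sB0 : sqs B0) (sG : forall j, sqs (G j)).
Hypothesis dG : forall i j, i != j -> [disjoint G i & G j].

Definition system (i : A + 'I_m) : {set {set X * bool}} :=
  match i with
  | inl a => blocks (lindner_blocks B0 (al a) (be a))
  | inr j => blocks (doubling_blocks (G j) p (fun c => p (c + kap j)%R))
  end.

Lemma sqs_system i : sqs (system i).
Proof.
case: i => [a|j] /=; apply: sqs_blocks; first exact: lindner_quad_list.
apply: doubling_quad_list => //.
- exact: pI.
- exact: pN.
- by move=> c; exact: pI.
- by move=> c; exact: pN.
- by move=> x y xy; exists (lam x y); exact: p_lam.
- by move=> x y xy; exists (lam x y - kap j)%R; rewrite subrK p_lam.
Qed.

Lemma set2_eq (x y u v : X) : x != y -> [set x; y] = [set u; v] ->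
  (x = u /\ y = v) \/ (x = v /\ y = u).
Proof.
move=> xy e; have : x \in [set u; v] by rewrite -e set21.
have : y \in [set u; v] by rewrite -e set22.
rewrite !inE => /orP[] /eqP ey /orP[] /eqP ex; subst; rewrite ?eqxx // in xy; auto.
Qed.

(** Slice sizes force both blocks into the same family. A triple lies in one block of [B0], so in
    the first two families w is common and the rows agree somewhere. For two pairs, the rows agree
    at x or form a 2 x 2 subsquare. *)
Lemma lindner_disjoint a a' s : a != a' -> s \in system (inl a) -> s \in system (inl a') -> False.
Proof.
move=> aa; have be_inj u : be a u = be a' u -> False.
  move=> e; move/eqP: aa; apply; apply: (al_inj (x := be a u)).
  by rewrite beK e beK.
have k3 b w : b \in B0 -> w \in b -> #|b :\ w| = 3.
  by move=> bB wb; have := cardsD1 w b; rewrite wb sB0.1 // => -[].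
have tri b w b' w' : b \in B0 -> w \in b -> b' \in B0 -> w' \in b' ->
    b :\ w = b' :\ w' -> w = w'.
  move=> bB wb bB' wb' e; have /eqP/cards1P[d dE] := sB0.2 _ (k3 b w bB wb).
  have : b \in [set d0 in B0 | b :\ w \subset d0] by rewrite inE bB subD1set.
  have : b' \in [set d0 in B0 | b :\ w \subset d0] by rewrite inE bB' e subD1set.
  rewrite dE !inE => /eqP eb' /eqP eb; subst b b'.
  apply/eqP; apply: contraT => ww; have : w \in d :\ w by rewrite e !inE ww.
  by rewrite !inE eqxx.
have pair x y : x != y -> al a x != al a y by rewrite (can_eq (alK a)).
case/lindnerP=> [[b [w [bB wb e0 e1]]]|[b [w [bB wb e1 e0]]]|[x [y [xy e0 e1]]]];
case/lindnerP=> [[b' [w' [bB' wb' e0' e1']]]|[b' [w' [bB' wb' e1' e0']]]|[x' [y' [xy' e0' e1']]]];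
move: e0' e1'; rewrite e0 e1 => e0' e1'.
- have ww := tri _ _ _ _ bB wb bB' wb' e0'; move/set1_inj: e1'; rewrite -ww => /al_inj aa'.
  by rewrite aa' eqxx in aa.
- by have := k3 b w bB wb; rewrite e0' cards1.
- by have := k3 b w bB wb; rewrite e0' cards2 xy'.
- by have := k3 b' w' bB' wb'; rewrite -e0' cards1.
- have ww := tri _ _ _ _ bB wb bB' wb' e1'; move/set1_inj: e0'; rewrite -ww.
  exact: be_inj.
- by have := cards1 (be a w); rewrite e0' cards2 xy'.
- by have := k3 b' w' bB' wb'; rewrite -e0' cards2 xy.
- by have := cards1 (be a' w'); rewrite -e0' cards2 xy.
move/eqP: aa; apply; have [[ex ey]|[ex ey]] := set2_eq xy e0'; subst x' y'.
  by have [[/al_inj]|[e e']] := set2_eq (pair _ _ xy) e1'; last exact: al_swap e e'.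
have [[e e']|[/al_inj]//] := set2_eq (pair _ _ xy) e1'.
exact: al_swap xy e e'.
Qed.

(** A crossing block shows c on one side and c + kap on the other, which recovers the index; other
    common blocks would lie in two of the disjoint systems. *)
Lemma doubling_disjoint i j s : i != j -> s \in system (inr i) -> s \in system (inr j) -> False.
Proof.
move=> ij; have no b : b \in G i -> b \in G j -> False.
  by move=> bi bj; move: (dG ij); rewrite disjoint_subset => /subsetP/(_ b bi); rewrite inE bj.
have c4 k b : b \in G k -> #|b| = 4 by exact: (sG k).1.
have pc c x : [set x; p c x] = set0 -> False by move/setP/(_ x); rewrite !inE eqxx.
have c2 c x : #|[set x; p c x]| = 2 by rewrite cards2 [_ == _]eq_sym pN.
case/doublingP=> [[g0 g1]|[g0 g1]|[c [x [z [g0 g1]]]]];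
case/doublingP=> [[h0 h1]|[h0 h1]|[c' [x' [z' [h0 h1]]]]].
- exact: no g0 h0.
- by have := c4 _ _ g0; rewrite h0 cards0.
- by have := c4 _ _ g0; rewrite h0 c2.
- by have := c4 _ _ h0; rewrite g0 cards0.
- exact: no g1 h1.
- by apply: (pc c' x'); rewrite -h0.
- by have := c4 _ _ h0; rewrite g0 c2.
- by apply: (pc c x); rewrite -g0.
have lp k d u v : [set u; p d u] = [set v; p k v] -> d = k.
  move=> e; have u_pu : u != p d u by rewrite eq_sym pN.
  have [[eu ev]|[eu ev]] := set2_eq u_pu e.
    by rewrite -(lam_p d u) ev eu lam_p.
  by rewrite -(lam_p d u) ev eu lamC lam_p.
have e0 : [set x; p c x] = [set x'; p c' x'] by rewrite -g0 h0.
have e1 : [set z; p (c + kap i)%R z] = [set z'; p (c' + kap j)%R z'] by rewrite -g1 h1.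
have ec := lp _ _ _ _ e0; have := lp _ _ _ _ e1; rewrite ec => /addrI/kap_inj eij.
by rewrite eij eqxx in ij.
Qed.

(** Only the shape with two points in each half is common to both kinds, and there [kap_al] compares
    the colours. *)
Lemma lindner_doubling_disjoint a j s : s \in system (inl a) -> s \in system (inr j) -> False.
Proof.
have k3 b w : b \in B0 -> w \in b -> #|b :\ w| = 3.
  by move=> bB wb; have := cardsD1 w b; rewrite wb sB0.1 // => -[].
have c4 b : b \in G j -> #|b| = 4 by exact: (sG j).1.
have c2 c x : #|[set x; p c x]| = 2 by rewrite cards2 [_ == _]eq_sym pN.
case/lindnerP=> [[b [w [bB wb e0 e1]]]|[b [w [bB wb e1 e0]]]|[x [y [xy e0 e1]]]];
case/doublingP=> [[h0 h1]|[h0 h1]|[c [u [z [h0 h1]]]]].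
- by have := c4 _ h0; rewrite e0 k3.
- by have := k3 b w bB wb; rewrite -e0 h0 cards0.
- by have := k3 b w bB wb; rewrite -e0 h0 c2.
- by have := c4 _ h0; rewrite e0 cards1.
- by have := cards1 (be a w); rewrite -e0 h0 cards0.
- by have := cards1 (be a w); rewrite -e0 h0 c2.
- by have := c4 _ h0; rewrite e0 cards2 xy.
- by have : #|[set x; y]| = 2; [rewrite cards2 xy | rewrite -e0 h0 cards0].
have f0 : [set x; y] = [set u; p c u] by rewrite -e0 h0.
have f1 : [set al a x; al a y] = [set z; p (c + kap j)%R z] by rewrite -e1 h1.
have lc : lam x y = c.
  by have [[-> ->]|[-> ->]] := set2_eq xy f0; [rewrite lam_p | rewrite lamC lam_p].
have axy : al a x != al a y by rewrite (can_eq (alK a)).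
have /eqP[] := kap_al a j xy; rewrite lc.
by have [[-> ->]|[-> ->]] := set2_eq axy f1; [rewrite lam_p | rewrite lamC lam_p].
Qed.

Lemma has_disjoint_sqs_assembly : has_disjoint_sqs (2 * #|X|) (#|A| + m).
Proof.
have <- : #|{: X * bool}| = 2 * #|X| by rewrite card_prod card_bool mulnC.
have <- : #|{: A + 'I_m}| = #|A| + m by rewrite card_sum card_ord.
apply: (has_disjoint_sqs_type sqs_system) => i j ij.
rewrite disjoint_subset; apply/subsetP => s si; rewrite inE; apply/negP => sj.
case: i j ij si sj => [a|i] [a'|j] ij si sj.
- by apply: lindner_disjoint si sj; apply: contra ij => /eqP->.
- exact: lindner_doubling_disjoint si sj.
- exact: lindner_doubling_disjoint sj si.
- by apply: doubling_disjoint si sj; apply: contra ij => /eqP->.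
Qed.

End Assembly.


(** * The coloured one-factorization and the Latin square *)

Lemma val_ordD k (x y : 'I_k.+1) :
  nat_of_ord (x + y)%R = if x + y < k.+1 then x + y else x + y - k.+1.
Proof.
rewrite /=; case: ltnP => xy; first by rewrite modn_small.
have := ltn_ord x; have := ltn_ord y => ly lx.
by rewrite -{1}(subnK xy) modnDr modn_small; lia.
Qed.

Lemma val_ordN k (x : 'I_k.+1) : 0 < x -> nat_of_ord (- x)%R = k.+1 - x.
Proof. by move=> x0; rewrite /= modn_small //; lia. Qed.

Lemma pair_inj (T U : Type) (x x' : T) (y y' : U) : (x, y) = (x', y') -> x = x' /\ y = y'.
Proof. by case=> -> ->. Qed.

Section Colouring.
Variable h : nat.
Local Notation n := (h.*2.+1).
Local Notation Z := 'I_(h.*2).+1.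
Local Notation X := (Z * bool)%type.

(* For 0 < D <= h this is a proper 3-colouring of the cycles a -> a + D. *)
Definition tint (D a : nat) : nat := if n - D <= a then 2 else odd (a %/ D).

Lemma tint_le2 D a : tint D a <= 2.
Proof. by rewrite /tint; case: ifP => // _; case: odd. Qed.

Lemma tint_proper D (a : Z) : 0 < D <= h -> tint D a != tint D (a + inord D)%R.
Proof.
move=> Dh; rewrite val_ordD inordK; last by lia.
have an := ltn_ord a; rewrite /tint; case: ltnP => aD.
  have -> : (n - D <= a) = false by lia.
  case: ifP => _; first by case: odd.
  by rewrite divnDr ?divnn // (_ : 0 < D) ?addn1 //=; [case: odd | lia].
have -> : n - D <= a by lia.
have -> : (n - D <= a + D - n) = false by lia.
by rewrite divn_small //; lia.
Qed.

(* The edges of difference +-D in both fibres, together with the rungs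
   (a, false)-(a + 2(D-1), true), form a cubic graph; its edges get the colours
   4(D-1), 4(D-1)+1, 4(D-1)+2. *)
Definition rail (D : nat) (i : bool) (a : Z) : nat :=
  4 * (D - 1) + tint D (if i then a - inord (2 * (D - 1)) else a)%R.

(** [rail] shifts the tints of the second fibre by 2(D - 1), so both ends of the rung at a see the
    rail tints of a and a - D; 3 minus their sum is the third tint. The odd differences and 2h are
    one-factors by themselves. *)
Definition rung (m : nat) (a : Z) : nat :=
  if odd m then 4 * m./2 + 3 else if m == h.*2 then 4 * h
  else 4 * m./2 + (3 - tint m./2.+1 a - tint m./2.+1 (a - inord m./2.+1)%R).

Definition colour (x y : X) : nat :=
  if x.2 == y.2 then
    let D := nat_of_ord (y.1 - x.1)%R in
    if D <= h then rail D x.2 x.1 else rail (n - D) x.2 y.1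
  else if x.2 then rung (x.1 - y.1)%R y.1 else rung (y.1 - x.1)%R x.1.

Lemma colourE a b i j : colour (a, i) (b, j) =
  if i == j then if (b - a)%R <= h then rail (b - a)%R i a else rail (n - (b - a)%R) i b
  else if i then rung (a - b)%R b else rung (b - a)%R a.
Proof. by []. Qed.

Definition jump (i : bool) (m : nat) (a : Z) : Z := if i then (a - inord m)%R else (a + inord m)%R.

(** c %/ 4 gives D and the possible rungs; of the edges in the cubic graph, the rails forward and
    backward are tried first, and the rung is what remains. *)
Definition mate (c : nat) (x : X) : X :=
  let: (a, i) := x in
  let D := (c %/ 4).+1 in
  if c %/ 4 == h then (jump i h.*2 a, ~~ i)
  else if c %% 4 == 3 then (jump i (2 * (c %/ 4) + 1) a, ~~ i)
  else if rail D i a == c then ((a + inord D)%R, i)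
  else if rail D i (a - inord D)%R == c then ((a - inord D)%R, i)
  else (jump i (2 * (c %/ 4)) a, ~~ i).

Lemma rail_bounds D i a : 0 < D -> 4 * (D - 1) <= rail D i a <= 4 * (D - 1) + 2.
Proof. by move=> D0; rewrite /rail leq_addr leq_add2l tint_le2. Qed.

Lemma rail_proper D i a : 0 < D <= h -> rail D i a != rail D i (a + inord D)%R.
Proof.
move=> Dh; rewrite /rail eqn_add2l; case: i; last exact: tint_proper.
by rewrite addrAC tint_proper.
Qed.

Lemma jump_rung i m (a b : Z) : m = nat_of_ord (b - a)%R -> jump i m (if i then b else a) = if i then a else b.
Proof.
move=> ->; rewrite /jump inord_val; case: i; last by rewrite addrC subrK.
by rewrite opprB addrC subrK.
Qed.

Lemma mate_rail D i a : 0 < D <= h ->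
  mate (rail D i a) (a, i) = ((a + inord D)%R, i) /\
  mate (rail D i a) ((a + inord D)%R, i) = (a, i).
Proof.
move=> Dh; have /andP[r1 r2] := @rail_bounds D i a ltac:(lia).
have rD : (rail D i a %/ 4).+1 = D by lia.
have rh : (rail D i a %/ 4 == h) = false by lia.
have r3 : (rail D i a %% 4 == 3) = false by lia.
rewrite /mate rD rh r3 eqxx addrK eqxx; split=> //.
by rewrite eq_sym (negPf (rail_proper _ _ Dh)).
Qed.

Lemma rung_bounds m a : m <= h.*2 -> 4 * m./2 <= rung m a <= 4 * m./2 + 3.
Proof.
move=> mh; rewrite /rung; have t1 := tint_le2 m./2.+1 a.
have t2 := tint_le2 m./2.+1 (a - inord m./2.+1)%R.
case: ifP => _; first by lia.
case: eqP => [->|_]; last by lia.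
by lia.
Qed.

Lemma mate_rung i (a b : Z) :
  mate (rung (b - a)%R a) ((if i then b else a), i) = ((if i then a else b), ~~ i).
Proof.
pose m := nat_of_ord (b - a)%R; have mh : m <= h.*2 by rewrite -ltnS ltn_ord.
have jm k : k = m -> jump i k (if i then b else a) = if i then a else b.
  by move=> ->; exact: jump_rung.
have mE : inord m = (b - a)%R :> Z by rewrite inord_val.
rewrite /mate -/m; clearbody m; rewrite /rung; case: (boolP (odd m)) => om.
  have -> : ((4 * m./2 + 3) %/ 4 == h) = false by lia.
  have -> : (4 * m./2 + 3) %% 4 = 3 by lia.
  by rewrite eqxx jm //; lia.
case: (eqVneq m h.*2) => [em|em].
  have -> : 4 * h %/ 4 == h by lia.
  by rewrite jm.
pose D := m./2.+1; rewrite -/D; have Dh : 0 < D <= h by rewrite /D; lia.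
set s := 3 - _ - _.
have t1 := tint_le2 D a; have t2 := tint_le2 D (a - inord D)%R.
have t3 : tint D a != tint D (a - inord D)%R.
  by rewrite eq_sym -{2}[a](subrK (inord D)); exact: tint_proper.
have s2 : s <= 2 by rewrite /s; lia.
have sa : s != tint D a by rewrite /s; lia.
have sb : s != tint D (a - inord D)%R by rewrite /s; lia.
have -> : ((4 * m./2 + s) %/ 4 == h) = false by rewrite /D in Dh; lia.
have -> : (4 * m./2 + s) %% 4 == 3 = false by lia.
have -> : (4 * m./2 + s) %/ 4 = m./2 by lia.
have ea : (if i then (if i then b else a) - inord (2 * (D - 1)) else (if i then b else a))%R = a.
  have -> : 2 * (D - 1) = m by rewrite /D; lia.
  by case: (i); rewrite // mE opprB addrC subrK.
have Dm : D - 1 = m./2 by rewrite /D subn1.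
have -> : rail m./2.+1 i (if i then b else a) == 4 * m./2 + s = false.
  by rewrite /rail -/D ea Dm eqn_add2l eq_sym (negPf sa).
have -> : rail m./2.+1 i ((if i then b else a) - inord m./2.+1)%R == 4 * m./2 + s = false.
  have eb : (if i then (if i then b else a) - inord D - inord (2 * (D - 1)) else
      (if i then b else a) - inord D)%R = (a - inord D)%R.
    by rewrite -{3}ea; case: (i) => //; rewrite addrAC.
  by rewrite /rail -/D eb Dm eqn_add2l eq_sym (negPf sb).
by rewrite jm //; lia.
Qed.

Lemma mate_colour x y : x != y -> mate (colour x y) x = y.
Proof.
case: x y => [a i] [b j] xy; rewrite colourE; have [ij|ij] := eqVneq i j.
  subst j; have ab : (b - a != 0)%R by rewrite subr_eq0; apply: contra xy => /eqP->.
  have D0 : 0 < nat_of_ord (b - a)%R by rewrite lt0n.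
  have [Dh|Dh] := leqP (nat_of_ord (b - a)%R) h.
    have [|-> _] := @mate_rail (b - a)%R i a; first by rewrite D0.
    by rewrite inord_val addrC subrK.
  have Dn := ltn_ord (b - a)%R.
  have [|_] := @mate_rail (n - (b - a)%R) i b; first by lia.
  by have -> : (b + inord (n - (b - a)%R) = a)%R by rewrite inord_opp // opprB addrC subrK.
have -> : j = ~~ i by case: i j ij {xy} => [] [].
by case: i {xy ij}; [exact: (mate_rung true) | exact: (mate_rung false)].
Qed.

Lemma colourC x y : colour x y = colour y x.
Proof.
case: x y => [a i] [b j]; rewrite !colourE [j == i]eq_sym; have [ij|ij] := eqVneq i j; last first.
  by case: i j ij => [] [].
subst j; have [->//|ab] := eqVneq a b.
have D0 : 0 < nat_of_ord (b - a)%R by rewrite lt0n (_ : 0 = (0 : Z)%R) // (inj_eq (@ord_inj _)) subr_eq0 eq_sym.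
have Dn := ltn_ord (b - a)%R.
have -> : nat_of_ord (a - b)%R = n - (b - a)%R.
  by rewrite -opprB val_ordN.
have [Dh|Dh] := leqP (nat_of_ord (b - a)%R) h.
  have -> : (n - (b - a)%R <= h) = false by lia.
  by rewrite subKn // ltnW.
by have -> : n - (b - a)%R <= h by lia.
Qed.

Lemma colour_lt x y : 0 < h -> colour x y < 4 * h + 1.
Proof.
move=> h0.
have rl D i a : D <= h -> rail D i a < 4 * h + 1.
  move=> Dh; rewrite /rail; have := tint_le2 D (if i then a - inord (2 * (D - 1)) else a)%R; lia.
have rg m a : m <= h.*2 -> rung m a < 4 * h + 1.
  move=> mh; have := @rung_bounds m a mh; rewrite /rung; case: eqP => [->|ne]; last by lia.
  by rewrite odd_double; lia.
case: x y => [a i] [b j]; rewrite colourE.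
have [_|_] := eqVneq i j; last by case: i; apply: rg; rewrite -ltnS ltn_ord.
have Dn := ltn_ord (b - a)%R; have [Dh|Dh] := leqP (nat_of_ord (b - a)%R) h; first exact: rl.
by apply: rl; lia.
Qed.

(** t - s lies between -2 and 3 modulo 4h + 1; the only wrap that occurs is from the last colour 4h
    upwards. *)
Definition close_colours (s t : nat) := (t <= s + 3) && (s <= t + 2) || (s == 4 * h) && (t <= 2).

(** The dihedral multiplication table except for [inord 1], the twist. *)
Definition slide (t : X) (x : X) : X :=
  let: (c, k) := t in let: (a, i) := x in
  if k then ((if i then c - a else c + inord 1 - a)%R, ~~ i) else ((a + c)%R, i).

Definition unslide (t : X) (x : X) : X :=
  let: (c, k) := t in let: (a, i) := x in
  if k then ((if i then c + inord 1 - a else c - a)%R, ~~ i) else ((a - c)%R, i).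

Lemma slideK t : cancel (slide t) (unslide t).
Proof.
case: t => [c [|]] [a i] /=; last by rewrite addrK.
by case: i => /=; rewrite subKr.
Qed.

Lemma unslideK t : cancel (unslide t) (slide t).
Proof.
case: t => [c [|]] [a i] /=; last by rewrite subrK.
by case: i => /=; rewrite subKr.
Qed.

Lemma slide_inj t t' x : slide t x = slide t' x -> t = t'.
Proof.
case: t t' x => [c k] [c' k'] [a i]; case: k k' i => [] [] []; rewrite /slide => E;
  have [e //= _] := pair_inj E; move: e;
  by first [move=> /addIr-> | move=> /addIr/addIr-> | move=> /addrI->].
Qed.

Lemma double_inj (a b : Z) : (a + a = b + b)%R -> a = b.
Proof.
move/(congr1 (@nat_of_ord _)); rewrite !val_ordD => e; apply: ord_inj.
have la := ltn_ord a; have lb := ltn_ord b; move: e.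
by case: (ltnP (a + a)) => ?; case: (ltnP (b + b)) => ? e; lia.
Qed.

(** Two rows of the same kind give 2c = 2c'. A translation and a reflection force x and y into
    different fibres and equate c with its twisted value. *)
Lemma slide_swap t t' x y : 0 < h -> x != y -> slide t x = slide t' y ->
  slide t y = slide t' x -> t = t'.
Proof.
move=> h0; have one : inord 1 != 0%R :> Z.
  by apply/eqP => /(congr1 (@nat_of_ord _)); rewrite inordK //=; lia.
have sum4 (u u' v v' : Z) : (u + v = u' + v' -> u + v' = u' + v -> u = u')%R.
  move=> e1 e2; apply: double_inj; apply: (@addIr _ (v + v')%R).
  by rewrite addrACA e1 e2 addrACA [(v' + v)%R]addrC.
have noshift (c : Z) : (c = c + inord 1 -> False)%R.
  by move=> e; case/eqP: one; apply: (@addrI _ c); rewrite -e addr0.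
case: t t' x y => [c k] [c' k'] [a i] [b j] xy E1 E2.
have mid u v w : (v - a = b + u -> w - b = a + u -> v = w)%R.
  move=> e1 e2; rewrite -[v](subrK a) -[w](subrK b) e1 e2.
  by rewrite addrAC [(b + a)%R]addrC [RHS]addrAC.
move: E1 E2; case: k k' i j {xy} => [] [] [] []; rewrite /slide => E1 E2;
  have [e1 //= _] := pair_inj E1; have [e2 _] := pair_inj E2.
- by rewrite (sum4 _ _ _ _ e1 e2).
- by have /addIr-> := sum4 _ _ _ _ e1 e2.
- by case: (noshift c (mid _ _ _ e1 e2)).
- by case: (noshift c (esym (mid _ _ _ e1 e2))).
- by case: (noshift c' (mid _ _ _ (esym e2) (esym e1))).
- by case: (noshift c' (esym (mid _ _ _ (esym e2) (esym e1)))).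
- by move: e1 e2; rewrite [(a + c)%R]addrC [(b + c)%R]addrC [(b + c')%R]addrC [(a + c')%R]addrC => e1 e2; rewrite (sum4 _ _ _ _ e1 e2).
- by move: e1 e2; rewrite [(a + c)%R]addrC [(b + c)%R]addrC [(b + c')%R]addrC [(a + c')%R]addrC => e1 e2; rewrite (sum4 _ _ _ _ e1 e2).
Qed.

(** Inside a fibre D is kept, and with it the three tints of its block. Across, m becomes m or m +
    1. A step from even to odd ends at the fourth colour of the block, a step from odd to even
    starts there: 1 to 3 colours up in both cases. From m = 2h the step leads to m = 0, from colour
    4h to 0, 1 or 2. *)
Lemma slide_colour t x y : x != y -> close_colours (colour x y) (colour (slide t x) (slide t y)).
Proof.
case: t x y => [c k] [a i] [b j] xy.
have rb D i' a' : 0 < D -> exists2 r, rail D i' a' = 4 * (D - 1) + r & r <= 2.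
  by move=> D0; exists (tint D (if i' then a' - inord (2 * (D - 1)) else a')%R); rewrite ?tint_le2.
have [ij|ij] := eqVneq i j.
  subst j; have {}xy : a != b by apply: contra xy => /eqP->.
  have D0 : 0 < nat_of_ord (b - a)%R by rewrite lt0n (_ : 0 = (0 : Z)%R) // (inj_eq (@ord_inj _)) subr_eq0 eq_sym.
  have Dn := ltn_ord (b - a)%R.
  have same a1 b1 i1 : (b1 - a1 = b - a)%R \/ (b1 - a1 = - (b - a))%R ->
      close_colours (colour (a, i) (b, i)) (colour (a1, i1) (b1, i1)).
    move=> H; rewrite !colourE !eqxx.
    have {H} : (nat_of_ord (b1 - a1)%R = (b - a)%R) \/ (nat_of_ord (b1 - a1)%R = n - (b - a)%R).
      by case: H => ->; [left | right; rewrite val_ordN].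
    move: (nat_of_ord (b1 - a1)%R) (nat_of_ord (b - a)%R) D0 Dn => d' d d0 dn dd.
    have [dh|dh] := leqP d h; have [dh'|dh'] := leqP d' h.
    + have [r -> r2] := rb d i a d0; have [|r' -> r2'] := rb d' i1 a1; first by lia.
      rewrite /close_colours; lia.
    + have [r -> r2] := rb d i a d0; have [|r' -> r2'] := rb (n - d') i1 b1; first by lia.
      rewrite /close_colours; lia.
    + have [|r -> r2] := rb (n - d) i b; first by lia.
      have [|r' -> r2'] := rb d' i1 a1; first by lia.
      rewrite /close_colours; lia.
    have [|r -> r2] := rb (n - d) i b; first by lia.
    have [|r' -> r2'] := rb (n - d') i1 b1; first by lia.
    rewrite /close_colours; lia.
  have flip u : (u - b - (u - a) = - (b - a))%R by rewrite !opprB addrC addrA subrK.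
  rewrite /slide; case: k; apply: same; last by left; rewrite [(a + c)%R]addrC addrKA.
  by right; case: (i); rewrite flip.
have -> : j = ~~ i by case: i j ij {xy} => [] [].
have rungP m a0 : m <= h.*2 -> exists2 r, rung m a0 = 4 * m./2 + r &
    [|| odd m && (r == 3), (m == h.*2) && (r == 0) | [&& ~~ odd m, m < h.*2 & r <= 2]].
  move=> mh; rewrite /rung; have [om|em] := boolP (odd m); first by exists 3.
  have [e2|ne] := eqVneq m h.*2; first by exists 0; [lia | lia].
  eexists; first reflexivity.
  have Dh : 0 < m./2.+1 <= h by lia.
  have := tint_proper (a0 - inord m./2.+1)%R Dh; rewrite subrK.
  by move: (tint _ _) (tint _ _) => t1 t2; lia.
have mixed a0 b0 a1 b1 : (b1 - a1 = b0 - a0)%R \/ (b1 - a1 = b0 - a0 + inord 1)%R ->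
    close_colours (rung (b0 - a0)%R a0) (rung (b1 - a1)%R a1).
  move=> H; have : nat_of_ord (b1 - a1)%R = (b0 - a0)%R \/
      nat_of_ord (b1 - a1)%R = (b0 - a0)%R + 1 \/
      nat_of_ord (b0 - a0)%R = h.*2 /\ nat_of_ord (b1 - a1)%R = 0.
    have := ltn_ord (b0 - a0)%R; case: H => -> d0; [by left | right].
    have [h0|h0] := posnP h.
      by right; have := ltn_ord (b0 - a0 + inord 1)%R; lia.
    by rewrite val_ordD inordK; [case: ltnP => ?; lia | lia].
  have := ltn_ord (b0 - a0)%R; have := ltn_ord (b1 - a1)%R.
  move: (nat_of_ord (b1 - a1)%R) (nat_of_ord (b0 - a0)%R) => m1 m0 m1h m0h mm.
  have [|r0 -> H0] := @rungP m0 a0; first by lia.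
  have [|r1 -> H1] := @rungP m1 a1; first by lia.
  rewrite /close_colours; lia.
have shift u v : (c + inord 1 - u - (c - v) = v - u + inord 1)%R.
  by rewrite opprB addrC !addrA subrK addrAC.
rewrite /slide; case: k; case: i {xy ij}.
- by apply: (mixed b a); right; rewrite shift.
- by apply: (mixed a b); right; rewrite shift.
- by apply: (mixed b a); left; rewrite [(b + c)%R]addrC addrKA.
- by apply: (mixed a b); left; rewrite [(a + c)%R]addrC addrKA.
Qed.

End Colouring.

Theorem theorem1 (n : nat) :
  7 <= n -> (n %% 6 == 1) || (n %% 6 == 5) ->
  2 * n + minn (D (2 * n)) (2 * n - 7) <= D (4 * n).
Proof.
move=> n7 n6; pose h := n./2; have h0 : 0 < h by rewrite /h; lia.
have nh : n = h.*2.+1 by rewrite /h; lia.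
pose X : finType := ('I_(h.*2).+1 * bool)%type.
have cX : #|X| = 2 * n by rewrite card_prod card_bool card_ord -nh mulnC.
have [B0 sB0] : exists B0 : {set {set X}}, sqs B0.
  by apply: sqs_exists_type; rewrite cX; apply: sqs_exists_2_4_mod_6; lia.
have [G [sG dG]] := disjoint_sqs_of cX (has_disjoint_sqs_D (2 * n)).
set m := minn _ _; have mD : m <= D (2 * n) by exact: geq_minl.
have m7 : m <= 2 * n - 7 by exact: geq_minr.
pose lam (x y : X) : 'I_(4 * h).+1 := inord (colour x y).
have lamE x y : nat_of_ord (lam x y) = colour x y by rewrite inordK // -[(4 * h).+1]addn1 colour_lt.
(* The shifts 0, ..., 3 are taken by the rows. As m <= 4h - 5, [kap] ends by 4h - 2 and avoids 4h -
   1 and 4h, which are -2 and -1. *)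
pose kap (j : 'I_m) : 'I_(4 * h).+1 := inord (j + 4).
have kapE j : nat_of_ord (kap j) = j + 4 by rewrite inordK //; have := ltn_ord j; lia.
apply: leq_D.
  (* The search range of [D] is large enough: 2n + m <= 4n <= 2^(4n). *)
  apply: leq_trans (ltnW (ltn_expl _ (ltnSn 1))).
  by apply: leq_trans (leq_add (leqnn _) m7) _; lia.
have -> : 4 * n = 2 * #|X| by rewrite cX mulnA.
rewrite -{1}cX.
apply: (@has_disjoint_sqs_assembly X X _ lam (fun c x => mate c x) _ _ _
  (@slide h) (@unslide h) _ _ _ _ m kap _ _ B0 (fun j => G (widen_ord mD j))) => //.
- by move=> x y; rewrite /lam colourC.
- by move=> x y xy; rewrite lamE mate_colour.
- by rewrite card_ord cX nh; lia.
- exact: slideK.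
- exact: unslideK.
- by move=> a a' x; exact: slide_inj.
- by move=> a a' x y; exact: slide_swap.
- move=> i j /(congr1 (@nat_of_ord _)); rewrite !kapE => /addIn; exact: ord_inj.
- move=> a x y j xy; apply/eqP => /(congr1 (@nat_of_ord _)); rewrite val_ordD !lamE kapE.
  have := slide_colour a xy; have := ltn_ord j; have := colour_lt x y h0.
  have := colour_lt (slide a x) (slide a y) h0; rewrite /close_colours.
  move: (colour _ _) (colour _ _) => s t; case: ifP; lia.
- by move=> i j ij; apply: dG; apply: contra ij => /eqP/(congr1 (@nat_of_ord _)) /= /ord_inj->.
Qed.
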